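(* Let $G=(V,E)$ be a $3$-colorable triangulation of the $2$-sphere and let $\alpha\colon V\to\{0,1,2,3\}$ be a $4$-coloring of $G$. Then $\alpha$ belongs to the $3$-coloring component of $\mathcal{R}_4(G)$ if and only if $\alpha$ satisfies the balanced condition: for every vertex $v\in V$, \[\#\varepsilon_{\alpha,v}^{-1}(+1)=\#\varepsilon_{\alpha,v}^{-1}(-1).\]
   Context: A triangulation of the $2$-sphere is (the $1$-skeleton $G$ of) a simplicial complex $K$ whose geometric realization is homeomorphic to $S^2$; its faces are the $2$-simplices. A $k$-coloring is a map $V\to\{0,\dots,k-1\}$ giving adjacent vertices distinct colors. A single-change recolors exactly one vertex (the result must again be a proper coloring). $\mathcal{R}_4(G)$ is the graph whose vertices are the $4$-colorings of $G$, two being adjacent iff they differ at exactly one vertex. A $3$-coloring here means a $4$-coloring using at most three colors; all such colorings lie in a single connected component of $\mathcal{R}_4(G)$, called the $3$-coloring component. Signatures: fix an orientation of $S^2$; for a face $f=\{u,v,w\}$ with $u,v,w$ listed in the positive (counterclockwise seen from outside) order, let $[\alpha(f)]$ be the cyclically ordered triple $[\alpha(u)\alpha(v)\alpha(w)]$. Set $\varepsilon_\alpha(f)=+1$ if $[\alpha(f)]$ is one of the cyclic orders $[123],[032],[013],[021]$, and $\varepsilon_\alpha(f)=-1$ otherwise (i.e., if it is the reverse of one of these). For $v\in V$, $\varepsilon_{\alpha,v}^{-1}(\pm1)$ denotes the set of faces containing $v$ with signature $\pm1$. *)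

(* Defs.v *)
From HB Require Import structures.
From mathcomp Require Import all_boot all_order all_algebra.
From mathcomp Require Import all_classical all_reals all_analysis.

Set Implicit Arguments.
Unset Strict Implicit.
Unset Printing Implicit Defensive.

Import Order.TTheory GRing.Theory Num.Theory.
Import numFieldNormedType.Exports.

Local Open Scope ring_scope.

Record simplicial_complex (V : finType) := SimplicialComplex {
  simplices :> {set {set V}};
  _ : finset.set0 \notin simplices;
  _ : forall v : V, [set v]%SET \in simplices;
  _ : forall s t : {set V},
        s \in simplices -> t \subset s -> t != finset.set0 -> t \in simplices
}.

Definition faces (V : finType) (K : simplicial_complex V) : {set {set V}} :=
  [set f in simplices K | #|f| == 3%N]%SET.

Definition skeleton (V : finType) (K : simplicial_complex V) : rel V :=
  fun u v => (u != v) && ([set u; v]%SET \in simplices K).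

(* Points are given by their barycentric coordinates in R^V; the coordinate at
   the vertex v has index enum_rank v. *)
Definition realization (R : realType) (V : finType) (K : simplicial_complex V) :
    set 'rV[R]_#|V| :=
  [set x | [/\ forall v : V, 0 <= x ord0 (enum_rank v),
               \sum_(v : V) x ord0 (enum_rank v) = 1
             & [set v : V | x ord0 (enum_rank v) != 0]%SET \in
               simplices K]]%classic.

Definition sphere2 (R : realType) : set 'rV[R]_3 :=
  [set x | \sum_(i < 3) x ord0 i ^+ 2 = 1]%classic.

(* Subspace topologies; the values of f outside A and of g outside B are
   irrelevant. *)
Definition homeomorphic (T U : topologicalType) (A : set T) (B : set U) : Prop :=
  exists (f : T -> U) (g : U -> T),
    [/\ {within A, continuous f}%classic /\ {within B, continuous g}%classic,
        set_fun A B f /\ set_fun B A g,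
        (forall x, A x -> g (f x) = x)
      & (forall y, B y -> f (g y) = y)].

Definition sphere_triangulation (R : realType) (V : finType)
    (K : simplicial_complex V) : Prop :=
  homeomorphic (@realization R V K) (@sphere2 R).

(* An orientation of the surface triangulated by K: positive u v w means that
   u, v, w is the positive order of the face {u, v, w}. The last axiom is
   coherence: two faces sharing the edge {u, v} induce opposite directions
   on it. *)
Record orientation (V : finType) (K : simplicial_complex V) := Orientation {
  positive :> V -> V -> V -> bool;
  _ : forall u v w : V,
        positive u v w -> uniq [:: u; v; w] /\ [set u; v; w]%SET \in faces K;
  _ : forall u v w : V, positive u v w = positive v w u;
  _ : forall u v w : V, [set u; v; w]%SET \in faces K ->
        positive u v w = ~~ positive u w v;
  _ : forall u v w w' : V, w != w' ->
        [set u; v; w]%SET \in faces K -> [set u; v; w']%SET \in faces K ->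
        positive u v w = positive v u w'
}.

Definition proper_coloring (V : finType) (k : nat) (e : rel V)
    (a : {ffun V -> 'I_k}) : bool :=
  [forall u, forall v, e u v ==> (a u != a v)].

Definition coloring (V : finType) (e : rel V) (k : nat) :=
  {a : {ffun V -> 'I_k} | proper_coloring e a}.

Definition colorable (V : finType) (e : rel V) (k : nat) : Prop :=
  exists a : {ffun V -> 'I_k}, proper_coloring e a.

Definition single_change (V : finType) (e : rel V) (k : nat) :
    rel (coloring e k) :=
  fun a b => #|[set v : V | val a v != val b v]%SET| == 1%N.

Definition three_coloring (V : finType) (e : rel V) (a : coloring e 4) : bool :=
  (#|[set val a v | v : V]%SET| <= 3)%N.

(* For a 3-colorable triangulation of the sphere all 3-colorings lie in a single
   component of the graph single_change, so this set is that component. *)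
Definition three_coloring_component (V : finType) (e : rel V) :
    {set coloring e 4} :=
  [set a | [exists b : coloring e 4,
              three_coloring b && connect (@single_change V e 4) b a]]%SET.

Definition positive_colors (a b c : 'I_4) : bool :=
  has (fun t : seq nat =>
         [:: val a; val b; val c] \in [:: t; rot 1 t; rot 2 t])
      [:: [:: 1; 2; 3]; [:: 0; 3; 2]; [:: 0; 1; 3]; [:: 0; 2; 1]]%N.

Definition signature (V : finType) (K : simplicial_complex V)
    (o : orientation K) (a : V -> 'I_4) (f : {set V}) : int :=
  if [exists u, exists v, exists w,
        [&& o u v w, f == [set u; v; w]%SET
          & positive_colors (a u) (a v) (a w)]]
  then 1 else -1.

Definition faces_at (V : finType) (K : simplicial_complex V)
    (o : orientation K) (a : V -> 'I_4) (v : V) (s : int) : {set {set V}} :=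
  [set f in faces K | (v \in f) && (signature o a f == s)]%SET.

Definition balanced (V : finType) (K : simplicial_complex V)
    (o : orientation K) (a : V -> 'I_4) : Prop :=
  forall v : V, #|faces_at o a v 1| = #|faces_at o a v (-1)|.

(* Main.v *)
(* Colours are the points of the projective line over F_3, and the tetrahedron
   on them is the reduction modulo 3 of the Farey complex, whose vertices are the
   primitive vectors of Z^2 up to sign and whose edges are the pairs of
   determinant 1 or -1. The link of a vertex v is a cycle; the signatures around v
   are the steps of a walk on the cyclically ordered three colours other than that
   of v, and balance at v means that this walk lifts to a closed walk on Z. So a
   balanced colouring lifts to the Farey complex on the star of every vertex, and,
   the sphere being simply connected, on the whole triangulation.
   Given a lift, a vertex where the positive definite form p^2 - pq + q^2 is
   maximal and greater than 1 has its neighbours among its two Farey parents x, y;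
   replacing x + y by x - y there is a single change which decreases the form.
   When all values are at most 1, three colours remain.
   Conversely the signed sum of the signatures around a vertex vanishes if its
   neighbours use two colours, and a single change at x alters it nowhere: at a
   neighbour of x, the two faces containing x keep opposite signatures.
   A link that is not a connected cycle is excluded by comparing |K| with the
   plane near a point: a punctured disc is connected, and a loop around its centre
   cannot be contracted along straight segments in a face. *)

Require Import Defs.
From mathcomp Require Import all_boot all_order all_algebra.
From mathcomp Require Import all_classical all_reals all_analysis.
From mathcomp Require Import zify ring lra.

Set Implicit Arguments.
Unset Strict Implicit.
Unset Printing Implicit Defensive.

Import Order.TTheory GRing.Theory Num.Theory.
Import numFieldNormedType.Exports.

Local Open Scope ring_scope.

(** * Continuity on subsets of coordinate spaces *)

(** The sphere is given only by a homeomorphism of coordinate sets, so the shape of links and simple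
    connectedness must both be drawn from that. One combinatorial device carries most of the
    topology: remove a point, read the rest in a planar chart, cut a square into a fine grid, label
    the grid points and transport data from label to label. If the transports compose on any three
    mutually near grid points, they have a global section ([grid_section]). With sectors of a
    punctured plane as labels and integers as data this is a winding number; with vertices as labels
    and lifts of stars as data it is lifting over a simply connected surface. The removed point is
    free, and is chosen off the points that the argument has to see. On the arithmetic side, the
    neighbours q + h a of a Farey vertex a have slopes modulo 3 depending only on h modulo 3; so one
    integer function around a vertex gives the lift of its link and, modulo 3, the colours. The form
    p^2 - pq + q^2 is chosen because its vectors of value 1 are, up to sign, (1,0), (0,1), (1,1): a
    single Farey triangle. *)

Definition near_at (R : realType) (I : Type) (A : (I -> R) -> Prop) (x : I -> R) :
    set_system (I -> R) :=
  fun P => exists d : R, 0 < d /\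
    forall y, A y -> (forall i, `|x i - y i| < d) -> P y.

Global Instance near_at_filter (R : realType) (I : Type) (A : (I -> R) -> Prop)
  (x : I -> R) : Filter (near_at A x).
Proof.
split.
- by exists 1.
- move=> P Q [d [d0 dP]] [e [e0 eQ]].
  exists (Num.min d e); split; first by rewrite lt_min d0 e0.
  move=> y Ay xy; split.
    by apply: dP => // i; have := xy i; rewrite lt_min => /andP[].
  by apply: eQ => // i; have := xy i; rewrite lt_min => /andP[].
- move=> P Q PQ [d [d0 dP]]; exists d; split => // y Ay xy.
  exact/PQ/dP.
Qed.

(** Convergence along the filter [near_at] gives access to the limit rules for sums, products and
    inverses; [map_cont_on] is the version uniform in the target coordinates. *)
Definition cont_on (R : realType) (I : Type) (A : (I -> R) -> Prop)
    (f : (I -> R) -> R) : Prop :=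
  forall x, A x -> (f y @[y --> near_at A x] --> f x)%classic.

Definition map_cont_on (R : realType) (I J : Type) (A : (I -> R) -> Prop)
    (f : (I -> R) -> (J -> R)) : Prop :=
  forall x, A x -> forall e, 0 < e -> exists d, 0 < d /\
    forall y, A y -> (forall i, `|x i - y i| < d) -> forall j, `|f x j - f y j| < e.

Lemma cont_onP (R : realType) (I : Type) (A : (I -> R) -> Prop) f :
  cont_on A f <-> map_cont_on A (fun x (_ : unit) => f x).
Proof.
split=> [cf x Ax e e0|cf x Ax].
  have /cvgrPdist_lt/(_ e e0)[d [d0 dP]] := cf x Ax.
  by exists d; split => // y Ay xy _; exact: dP.
apply/cvgrPdist_lt => e e0; have [d [d0 dP]] := cf x Ax e e0.
by exists d; split => // y Ay xy; exact: (dP y Ay xy tt).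
Qed.

Lemma cont_on_proj (R : realType) (I : Type) (A : (I -> R) -> Prop) i :
  cont_on A (fun x => x i).
Proof. by apply/cont_onP => x _ e e0; exists e; split. Qed.

Lemma map_cont_on_coord (R : realType) (I : Type) (J : finType)
    (A : (I -> R) -> Prop) (f : (I -> R) -> J -> R) :
  (forall j, cont_on A (fun x => f x j)) -> map_cont_on A f.
Proof.
move=> cf x Ax e e0.
have {}cf j : exists d, 0 < d /\ forall y, A y ->
    (forall i, `|x i - y i| < d) -> `|f x j - f y j| < e.
  have /cont_onP/(_ x Ax e e0)[d [d0 dP]] := cf j.
  by exists d; split => // y Ay xy; exact: (dP y Ay xy tt).
have [d dP] := choice cf.
exists (\big[Num.min/1]_j d j); split.
  by apply/bigmin_gtP; split => // j _; case: (dP j).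
move=> y Ay xy j; apply: (dP j).2 => // i.
by apply: lt_le_trans (xy i) _; exact: bigmin_le_cond.
Qed.

Lemma map_cont_on_comp (R : realType) (I J L : Type) (A : (I -> R) -> Prop)
    (B : (J -> R) -> Prop) (g : (I -> R) -> (J -> R)) (f : (J -> R) -> (L -> R)) :
  map_cont_on A g -> (forall x, A x -> B (g x)) -> map_cont_on B f ->
  map_cont_on A (fun x => f (g x)).
Proof.
move=> cg AB cf x Ax e e0.
have [d [d0 dP]] := cf _ (AB x Ax) e e0.
have [d' [d'0 d'P]] := cg x Ax d d0.
by exists d'; split => // y Ay xy; apply: dP; [exact: AB|exact: d'P].
Qed.

Lemma map_cont_onW (R : realType) (I J : Type) (A B : (I -> R) -> Prop)
    (f : (I -> R) -> (J -> R)) :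
  (forall x, B x -> A x) -> map_cont_on A f -> map_cont_on B f.
Proof.
move=> BA cf x Bx e e0; have [d [d0 dP]] := cf x (BA x Bx) e e0.
by exists d; split => // y By; exact/dP/BA.
Qed.

(** * Compactness of a square *)

Section box.
Variables (R : realType) (a b : R).

Definition box (z : bool -> R) : Prop := forall i, a <= z i <= b.

(** A Lebesgue number for any property that passes to smaller radii. The radius may also serve as a
    bound: a lower bound for a map without zeros or, inverted, an upper bound for a continuous
    map. *)
Lemma box_covering (P : R -> (bool -> R) -> Prop) :
  (forall d d' z, 0 < d' -> d' <= d -> P d z -> P d' z) ->
  (forall z, box z -> exists d, 0 < d /\
     forall y, box y -> (forall i, `|z i - y i| < d) -> P d y) ->
  exists d, 0 < d /\ forall z, box z -> P d z.
Proof.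
move=> Pmono Ploc.
pose mk (p : R * R) := fun i : bool => if i then p.1 else p.2.
have cK : compact (`[a, b]%classic `*` `[a, b]%classic : set (R * R)).
  by apply: compact_setX; exact: segment_compact.
have mkbox p : (`[a, b]%classic `*` `[a, b]%classic)%classic p <-> box (mk p).
  split=> [[/= ]|bp]; first by rewrite !in_itv /= => p1 p2 [].
  by split; rewrite /= in_itv /=; [exact: (bp true)|exact: (bp false)].
have /compact_near_coveringP/near_covering_withinP := cK.
move=> /(_ R (0 : R)^'+%classic (fun d p => P d (mk p)) _) ncov.
have : (\forall d \near (0:R)^'+,
    ((`[a, b]%classic `*` `[a, b]%classic) `<=` (fun p => P d (mk p))))%classic.
  apply: ncov => p /mkbox /Ploc[d [d0 dP]].
  exists (ball p d, [set e | 0 < e <= d]%classic) => /=.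
    split; first exact: nbhsx_ballx.
    near=> e; apply/andP; split; [by near: e; exact: nbhs_right_gt|].
    by near: e; exact: nbhs_right_le.
  move=> [q e] [/= pq /andP[e0 ed]] /mkbox bq.
  apply: (Pmono d) => //; apply: dP => // i.
  by case: pq; rewrite -!ball_normE /= => ? ?; case: i.
move=> ncv; near (0:R)^'+%classic => d.
have d0 : 0 < d by near: d; exact: nbhs_right_gt.
have dP : ((`[a, b]%classic `*` `[a, b]%classic) `<=` (fun p => P d (mk p)))%classic.
  by near: d; exact: ncv.
exists d; split => // z bz.
have -> : z = mk (z true, z false) by apply/funext => -[].
by apply: dP; apply/mkbox => -[]; exact: bz.
Unshelve. all: by end_near. Qed.

Lemma box_uniform_cont (J : Type) (f : (bool -> R) -> J -> R) :
  map_cont_on box f -> forall e, 0 < e -> exists d, 0 < d /\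
  forall z y, box z -> box y -> (forall i, `|z i - y i| < d) ->
  forall j, `|f z j - f y j| < e.
Proof.
move=> cf e e0.
have [d [d0 dP]] : exists d, 0 < d /\ forall z, box z ->
    forall y, box y -> (forall i, `|z i - y i| < d) -> forall j, `|f z j - f y j| < e.
  apply: box_covering => [d d' z d'0 dd' H y By zy j|z bz].
    by apply: H => // i; exact: lt_le_trans (zy i) _.
  have [d [d0 dP]] := cf z bz (e / 2) ltac:(lra).
  exists (d / 2); split; first lra.
  move=> y By zy x Bx yx j.
  have dd : d / 2 < d by lra.
  have := dP y By (fun i => lt_trans (zy i) dd) j.
  have : `|f z j - f x j| < e / 2.
    apply: dP => // i; have := zy i; have := yx i; rewrite !ltr_norml.
    by move=> /andP[? ?] /andP[? ?]; apply/andP; split; lra.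
  rewrite !ltr_norml => /andP[? ?] /andP[? ?]; apply/andP; split; lra.
by exists d; split => // z y bz By; exact: dP.
Qed.

End box.

(** * A planar chart of the sphere minus a point *)

Section cont_on_algebra.
Variables (R : realType) (I : Type) (A : (I -> R) -> Prop).
Implicit Types f g : (I -> R) -> R.

Lemma cont_on_cst (c : R) : cont_on A (fun=> c).
Proof. by move=> x _; exact: cvg_cst. Qed.

Lemma cont_onD f g : cont_on A f -> cont_on A g -> cont_on A (fun x => f x + g x).
Proof. by move=> cf cg x Ax; apply: cvgD; [exact: cf|exact: cg]. Qed.

Lemma cont_onB f g : cont_on A f -> cont_on A g -> cont_on A (fun x => f x - g x).
Proof. by move=> cf cg x Ax; apply: cvgB; [exact: cf|exact: cg]. Qed.

Lemma cont_onM f g : cont_on A f -> cont_on A g -> cont_on A (fun x => f x * g x).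
Proof. by move=> cf cg x Ax; apply: cvgM; [exact: cf|exact: cg]. Qed.

Lemma cont_onV f : (forall x, A x -> f x != 0) -> cont_on A f ->
  cont_on A (fun x => (f x)^-1).
Proof. by move=> f0 cf x Ax; apply: cvgV; [exact: f0|exact: cf]. Qed.

Lemma cont_on_norm f : cont_on A f -> cont_on A (fun x => `|f x|).
Proof. by move=> cf x Ax; apply: cvg_norm; exact: cf. Qed.

End cont_on_algebra.

Definition geom (R : realType) (V : finType) (K : simplicial_complex V)
    (x : V -> R) : Prop :=
  [/\ forall v, 0 <= x v, \sum_v x v = 1
    & [set v | x v != 0]%SET \in simplices K].

Definition sphere (R : realType) (y : 'I_3 -> R) : Prop :=
  \sum_i y i ^+ 2 = 1.

Lemma within_cont_row (R : realType) m n (A : set 'rV[R]_m)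
    (f : 'rV[R]_m -> 'rV[R]_n) : {within A, continuous f}%classic ->
  forall x, A x -> forall e, 0 < e -> exists d, 0 < d /\
  forall y, A y -> (forall i, `|x ord0 i - y ord0 i| < d) ->
  forall j, `|f x ord0 j - f y ord0 j| < e.
Proof.
move=> /subspace_continuousP cf x Ax e e0.
have := cf x Ax (ball (f x) e) (nbhsx_ballx _ _ e0).
rewrite /= nbhs_simpl /= => -/nbhs_ballP[d /= d0 dP].
exists d; split => // y Ay xy j.
have : ball (f x) e (f y).
  apply: dP => //; split => // i k; rewrite -ball_normE /=; have := xy k.
  by rewrite (ord1 i).
by move=> [_ /(_ ord0 j)]; rewrite -ball_normE.
Qed.

Lemma sphere_homeo (R : realType) (V : finType) (K : simplicial_complex V) :
  sphere_triangulation R K ->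
  exists (f : (V -> R) -> ('I_3 -> R)) (g : ('I_3 -> R) -> (V -> R)),
  [/\ map_cont_on (geom K) f, map_cont_on (@sphere R) g,
      forall x, geom K x -> sphere (f x) /\ g (f x) = x
    & forall y, sphere y -> geom K (g y) /\ f (g y) = y].
Proof.
move=> [f [g [[cf cg] [fAB gBA] gf fg]]].
pose rv (x : V -> R) : 'rV[R]_#|V| := \row_i x (enum_val i).
pose vr (r : 'rV[R]_#|V|) v := r ord0 (enum_rank v).
pose rw (x : 'I_3 -> R) : 'rV[R]_3 := \row_i x i.
pose wr (r : 'rV[R]_3) i := r ord0 i.
have rvK x : vr (rv x) = x by apply/funext => v; rewrite /vr mxE enum_rankK.
have vrK r : rv (vr r) = r by apply/rowP => v; rewrite mxE /vr enum_valK.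
have rwK x : wr (rw x) = x by apply/funext => v; rewrite /wr mxE.
have wrK r : rw (wr r) = r by apply/rowP => v; rewrite mxE.
have geomE r : realization K r <-> geom K (vr r) by [].
have sphE r : sphere2 r <-> sphere (wr r) by [].
have geomE' x : geom K x -> realization K (rv x) by rewrite geomE rvK.
have sphE' x : sphere x -> sphere2 (rw x) by rewrite sphE rwK.
exists (fun x => wr (f (rv x))), (fun y => vr (g (rw y))); split.
- move=> x Kx e e0.
  have [d [d0 dP]] := within_cont_row cf (geomE' x Kx) e0.
  exists d; split => // y Ky xy j; apply: dP; first exact: geomE'.
  by move=> i; rewrite !mxE.
- move=> x Kx e e0.
  have [d [d0 dP]] := within_cont_row cg (sphE' x Kx) e0.
  exists d; split => // y Ky xy j; apply: dP; first exact: sphE'.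
  by move=> i; rewrite !mxE.
- move=> x Kx; split; first exact/sphE/fAB/geomE'.
  by rewrite wrK gf ?rvK//; exact: geomE'.
- move=> y Sy; split; first exact/geomE/gBA/sphE'.
  by rewrite vrK fg ?rwK//; exact: sphE'.
Qed.

Definition vec3 (R : realType) (a b c : R) : 'I_3 -> R := fun i => nth 0 [:: a; b; c] i.

Local Notation i0 := (ord0 : 'I_3).
Local Notation i1 := (Ordinal (isT : (1 < 3)%N)).
Local Notation i2 := (Ordinal (isT : (2 < 3)%N)).

Lemma ord3P (P : 'I_3 -> Prop) : P i0 -> P i1 -> P i2 -> forall i, P i.
Proof.
move=> h0 h1 h2 [[|[|[|//]]] h].
- by rewrite (_ : Ordinal h = i0) //; exact/val_inj.
- by rewrite (_ : Ordinal h = i1) //; exact/val_inj.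
- by rewrite (_ : Ordinal h = i2) //; exact/val_inj.
Qed.

Lemma sphereE (R : realType) (y : 'I_3 -> R) :
  sphere y <-> y i0 ^+ 2 + y i1 ^+ 2 + y i2 ^+ 2 = 1.
Proof.
rewrite /sphere !big_ord_recl big_ord0 addr0 addrA.
rewrite (_ : lift ord0 ord0 = i1); last exact/val_inj.
by rewrite (_ : lift ord0 (lift ord0 ord0) = i2); last exact/val_inj.
Qed.

(* The reflection exchanging the unit vector c and the north pole. When c is
   the north pole, the division by 0 gives 0 and this is the identity. *)
Definition pole_reflection (R : realType) (c y : 'I_3 -> R) : 'I_3 -> R :=
  let k := (y i0 * c i0 + y i1 * c i1 + y i2 * c i2 - y i2) / (1 - c i2) in
  vec3 (y i0 - k * c i0) (y i1 - k * c i1) (y i2 - k * (c i2 - 1)).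

Lemma pole_reflection_cont (R : realType) (c : 'I_3 -> R) A :
  map_cont_on A (pole_reflection c).
Proof.
have ck : cont_on A (fun y : 'I_3 -> R =>
    (y i0 * c i0 + y i1 * c i1 + y i2 * c i2 - y i2) / (1 - c i2)).
  apply: cont_onM; last exact: cont_on_cst.
  have cy i : cont_on A (fun y : 'I_3 -> R => y i * c i).
    by apply: cont_onM; [exact: cont_on_proj|exact: cont_on_cst].
  apply: cont_onB; last exact: cont_on_proj.
  by apply: cont_onD => //; apply: cont_onD.
have H i t : cont_on A (fun y : 'I_3 -> R => y i -
    (y i0 * c i0 + y i1 * c i1 + y i2 * c i2 - y i2) / (1 - c i2) * t).
  apply: cont_onB; first exact: cont_on_proj.
  by apply: cont_onM => //; exact: cont_on_cst.
by apply: map_cont_on_coord; apply: ord3P; exact: H.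
Qed.

Lemma pole_reflectionK (R : realType) (c y : 'I_3 -> R) : sphere c ->
  pole_reflection c (pole_reflection c y) = y.
Proof.
move=> /sphereE Sc; apply/funext; have [c1|c1] := eqVneq (c i2) 1.
  apply: ord3P; rewrite /pole_reflection /vec3 /= c1 subrr invr0; ring.
have nz : 1 - c i2 != 0 by rewrite subr_eq0 eq_sym.
(* The equation of the sphere, oriented as a rewriting rule for [field]. *)
have E0 : c i0 ^+ 2 = 1 - c i1 ^+ 2 - c i2 ^+ 2 by lra.
by apply: ord3P; rewrite /pole_reflection /vec3 /=; field: E0.
Qed.

Lemma pole_reflection_sphere (R : realType) (c y : 'I_3 -> R) : sphere c ->
  sphere y -> sphere (pole_reflection c y).
Proof.
move=> /sphereE Sc /sphereE Sy; apply/sphereE; have [c1|c1] := eqVneq (c i2) 1.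
  by rewrite /pole_reflection /vec3 /= c1 subrr invr0; rewrite -[RHS]Sy; ring.
have nz : 1 - c i2 != 0 by rewrite subr_eq0 eq_sym.
have E0 : c i0 ^+ 2 = 1 - c i1 ^+ 2 - c i2 ^+ 2 by lra.
by rewrite -[RHS]Sy /pole_reflection /vec3 /=; field: E0.
Qed.

Lemma pole_reflection_center (R : realType) (c : 'I_3 -> R) : sphere c ->
  pole_reflection c c = vec3 0 0 1.
Proof.
move=> /sphereE Sc; apply/funext; have [c1|c1] := eqVneq (c i2) 1.
  have [c0 c1'] : c i0 = 0 /\ c i1 = 0 by rewrite c1 in Sc; split; nra.
  by apply: ord3P; rewrite /pole_reflection /vec3 /= c1 c0 c1'; ring.
have nz : 1 - c i2 != 0 by rewrite subr_eq0 eq_sym.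
have E0 : c i0 ^+ 2 = 1 - c i1 ^+ 2 - c i2 ^+ 2 by lra.
by apply: ord3P; rewrite /pole_reflection /vec3 /=; field: E0.
Qed.

Definition stereo (R : realType) (y : 'I_3 -> R) : bool -> R :=
  fun b => (if b then y i0 else y i1) / (1 - y i2).

Definition unstereo (R : realType) (z : bool -> R) : 'I_3 -> R :=
  let d := z true * z true + z false * z false + 1 in
  vec3 (2 * z true / d) (2 * z false / d) ((d - 2) / d).

Lemma unstereo_den (R : realType) (z : bool -> R) :
  z true * z true + z false * z false + 1 != 0.
Proof. by apply: lt0r_neq0; nra. Qed.

Lemma unstereo_sphere (R : realType) (z : bool -> R) : sphere (unstereo z).
Proof.
apply/sphereE; rewrite /unstereo /vec3 /=; field; exact: unstereo_den.
Qed.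

Lemma unstereo_pole (R : realType) (z : bool -> R) : unstereo z i2 != 1.
Proof.
have nz := unstereo_den z; rewrite /unstereo /vec3 /=.
set d := _ + 1 in nz *.
apply/eqP => /(congr1 (fun t => t * d)); rewrite divfK // mul1r => ?; lra.
Qed.

Lemma unstereoK (R : realType) (z : bool -> R) : stereo (unstereo z) = z.
Proof.
have nz := unstereo_den z.
apply/funext => -[]; rewrite /stereo /unstereo /vec3 /=; field; rewrite nz; apply/eqP; lra.
Qed.

Lemma stereoK (R : realType) (y : 'I_3 -> R) : sphere y -> y i2 != 1 ->
  unstereo (stereo y) = y.
Proof.
move=> /sphereE Sy y1; have nz : 1 - y i2 != 0 by rewrite subr_eq0 eq_sym.
have nz2 : y i0 * y i0 + y i1 * y i1 + (1 - y i2) * (1 - y i2) != 0.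
  suff -> : y i0 * y i0 + y i1 * y i1 + (1 - y i2) * (1 - y i2) = 2 * (1 - y i2).
    by rewrite mulf_neq0 // pnatr_eq0.
  by nra.
have E0 : y i0 ^+ 2 = 1 - y i1 ^+ 2 - y i2 ^+ 2 by lra.
apply/funext; apply: ord3P; rewrite /stereo /unstereo /vec3 /=; field: E0;
  by rewrite ?nz ?nz2.
Qed.

Lemma stereo_cont (R : realType) :
  map_cont_on (fun y : 'I_3 -> R => y i2 != 1) (@stereo R).
Proof.
have H i : cont_on (fun y : 'I_3 -> R => y i2 != 1) (fun y => y i / (1 - y i2)).
  apply: cont_onM; first exact: cont_on_proj.
  apply: cont_onV; last by apply: cont_onB; [exact: cont_on_cst|exact: cont_on_proj].
  by move=> y; rewrite subr_eq0 eq_sym.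
by apply: map_cont_on_coord => -[]; exact: H.
Qed.

Lemma unstereo_cont (R : realType) : map_cont_on (fun=> True) (@unstereo R).
Proof.
pose d (z : bool -> R) := z true * z true + z false * z false + 1.
have cz i : cont_on (fun=> True) (fun z : bool -> R => z i) by exact: cont_on_proj.
have cc (c : R) : cont_on (fun=> True) (fun z : bool -> R => c) by exact: cont_on_cst.
have cd : cont_on (fun=> True) d.
  by apply: cont_onD => //; apply: cont_onD; apply: cont_onM.
have cd' : cont_on (fun=> True) (fun z => (d z)^-1).
  by apply: cont_onV => // z _; exact: unstereo_den.
have H i : cont_on (fun=> True) (fun z => 2 * z i / d z).
  by apply: cont_onM => //; apply: cont_onM.
have H2 : cont_on (fun=> True) (fun z => (d z - 2) / d z).
  by apply: cont_onM => //; apply: cont_onB.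
by apply: map_cont_on_coord; apply: ord3P; [exact: H|exact: H|exact: H2].
Qed.

(** The reflection carries the image of [p0] to the north pole, so any chosen point can be the one
    sent to infinity. *)
Lemma plane_chart (R : realType) (V : finType) (K : simplicial_complex V)
    (p0 : V -> R) : sphere_triangulation R K -> geom K p0 ->
  exists (F : (V -> R) -> (bool -> R)) (G : (bool -> R) -> (V -> R)),
  [/\ map_cont_on (fun x => geom K x /\ x <> p0) F,
      map_cont_on (fun=> True) G,
      forall x, geom K x -> x <> p0 -> G (F x) = x
    & forall z, [/\ geom K (G z), G z <> p0 & F (G z) = z]].
Proof.
move=> /sphere_homeo[f [g [cf cg gf fg]]] Kp0.
have [Sc gc] := gf _ Kp0; set c := f p0 in Sc gc.
pose rho := pole_reflection c.
have rhoc : rho c = vec3 0 0 1 by exact: pole_reflection_center.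
have north y : sphere y -> y i2 = 1 -> y = vec3 0 0 1.
  move=> /sphereE Sy y1; have [? ?] : y i0 = 0 /\ y i1 = 0.
    by rewrite y1 in Sy; split; nra.
  by apply/funext; apply: ord3P.
have npole x : geom K x -> x <> p0 -> rho (f x) i2 != 1.
  move=> Kx xp0; apply/eqP => r1; apply: xp0.
  have [Sx gx] := gf x Kx.
  have : rho (f x) = rho c.
    by rewrite rhoc; apply: north => //; exact: pole_reflection_sphere.
  move/(congr1 rho); rewrite /rho !pole_reflectionK // => fxc.
  by rewrite -gx fxc.
exists (fun x => stereo (rho (f x))), (fun z => g (rho (unstereo z))); split.
- apply: (map_cont_on_comp (B := fun y => y i2 != 1)); last exact: stereo_cont.
    apply: (map_cont_on_comp (B := fun=> True)) => //; last exact: pole_reflection_cont.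
    by apply: map_cont_onW cf => x [].
  by move=> x []; exact: npole.
- apply: (map_cont_on_comp (B := @sphere R)) => //.
    apply: (map_cont_on_comp (B := fun=> True)) => //; first exact: unstereo_cont.
    exact: pole_reflection_cont.
  by move=> z _; apply: pole_reflection_sphere => //; exact: unstereo_sphere.
- move=> x Kx xp0; have [Sx gx] := gf x Kx.
  rewrite stereoK ?/rho ?pole_reflectionK //; first exact: pole_reflection_sphere.
  exact: npole.
- move=> z; have Su := unstereo_sphere z.
  have Sr : sphere (rho (unstereo z)) by exact: pole_reflection_sphere.
  have [Kg fgz] := fg _ Sr; split => //.
    move=> gp0; have := unstereo_pole z; apply/negP; rewrite negbK.
    have e : rho (unstereo z) = c by rewrite -fgz gp0.
    by rewrite -(pole_reflectionK (unstereo z) Sc) -/rho e rhoc.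
  by rewrite fgz /rho pole_reflectionK // unstereoK.
Qed.

(** * Flat transports on grids, and winding around a point *)

Definition near_cells (c c' : nat * nat) : Prop :=
  [/\ (c.1 <= c'.1.+1)%N, (c'.1 <= c.1.+1)%N, (c.2 <= c'.2.+1)%N
    & (c'.2 <= c.2.+1)%N].

(** [T y y'] carries data from label [y'] to label [y]. The section is spread along the bottom row
    and then up each column; flatness on unit squares makes it agree with the horizontal steps of
    the higher rows. *)
Lemma grid_section (Y X : Type) (lab : nat * nat -> Y) (ok : Y -> X -> Prop)
    (T : Y -> Y -> X -> X) (x0 : X) :
  (forall y x, ok y x -> T y y x = x) ->
  (forall c c' x, near_cells c c' -> ok (lab c') x ->
     ok (lab c) (T (lab c) (lab c') x)) ->
  (forall c1 c2 c3 x, near_cells c1 c2 -> near_cells c2 c3 -> near_cells c1 c3 ->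
     ok (lab c3) x ->
     T (lab c1) (lab c2) (T (lab c2) (lab c3) x) = T (lab c1) (lab c3) x) ->
  ok (lab (0, 0)%N) x0 ->
  exists k : nat * nat -> X, (forall c, ok (lab c) (k c)) /\
    forall c c', near_cells c c' -> k c = T (lab c) (lab c') (k c').
Proof.
move=> Tid Tok Tcomp ok0.
pose row := fix row i := if i is i'.+1 then
  T (lab (i, 0)%N) (lab (i', 0)%N) (row i') else x0.
pose kk := fix kk i j := if j is j'.+1 then
  T (lab (i, j)) (lab (i, j')) (kk i j') else row i.
have kok i j : ok (lab (i, j)) (kk i j).
  elim: j => [|j IHj]; last by apply: Tok => //; split => //=; lia.
  by elim: i => [//|i IHi]; apply: Tok => //; split => //=; lia.
have kv i j : kk i j.+1 = T (lab (i, j.+1)) (lab (i, j)) (kk i j) by [].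
(* Both ways around a unit square equal the transport along its diagonal; this is why diagonal
   neighbours count as near. *)
have kh i j : kk i.+1 j = T (lab (i.+1, j)) (lab (i, j)) (kk i j).
  elim: j => [//|j IHj].
  rewrite !kv IHj !Tcomp //; split => /=; lia.
have sym c c' : near_cells c c' -> kk c.1 c.2 = T (lab c) (lab c') (kk c'.1 c'.2) ->
    kk c'.1 c'.2 = T (lab c') (lab c) (kk c.1 c.2).
  move: c c' => [i j] [i' j'] /= [/= n1 n2 n3 n4] ->; rewrite Tcomp ?Tid //; split => /=; lia.
exists (fun c => kk c.1 c.2); split=> [[i j]|]; first exact: kok.
have main c c' : near_cells c c' -> (c'.1 <= c.1)%N ->
    kk c.1 c.2 = T (lab c) (lab c') (kk c'.1 c'.2).
  move: c c' => [i j] [i' j'] /= [/= n1 n2 n3 n4] le.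
  have vert a : kk a j = T (lab (a, j)) (lab (a, j')) (kk a j').
    have [e|[e|e]] : j = j' \/ j = j'.+1 \/ j' = j.+1 by lia.
    - by rewrite e Tid.
    - by rewrite e kv.
    - subst j'; apply: (sym (a, j.+1) (a, j)) => //; split => /=; lia.
  have [e|e] : i = i' \/ i = i'.+1 by lia.
    by rewrite e vert.
  by rewrite e kh vert Tcomp //; split => /=; lia.
move=> c c' n; have [le|lt] := leqP c'.1 c.1; first exact: main.
have n' : near_cells c' c by case: n; split.
by apply: (sym c' c n'); exact: main n' (ltnW lt).
Qed.

(** The closed first quadrant, the rest of the closed upper half-plane, the open lower half-plane:
    three sectors suffice to record winding. *)
Definition sector (R : realType) (q : bool -> R) : nat :=
  if q false < 0 then 2 else if q true < 0 then 1 else 0.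

Lemma sectorP (R : realType) (q : bool -> R) :
  [\/ sector q = 0%N /\ (0 <= q true /\ 0 <= q false), sector q = 1%N /\ q true < 0
    | sector q = 2%N /\ q false < 0].
Proof.
rewrite /sector; case: ltP => ?; first by constructor 3.
by case: ltP => ?; [constructor 2|constructor 1].
Qed.

(** The sectors have only the origin as a common limit: a point of the first quadrant within e of
    both others has both coordinates below e. *)
Lemma sector_clash (R : realType) (e : R) (q0 q1 q2 : bool -> R) :
  (exists i, e <= `|q0 i|) -> 0 <= q0 true -> 0 <= q0 false -> q1 true < 0 ->
  q2 false < 0 -> (forall i, `|q0 i - q1 i| < e) -> (forall i, `|q0 i - q2 i| < e) ->
  False.
Proof.
move=> [i ei] p0 p1 n1 n2 d1 d2.
move: (d1 true) (d2 false) ei; rewrite !ltr_norml => /andP[_ ?] /andP[_ ?].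
by case: i; rewrite ger0_norm // => ?; lra.
Qed.

Lemma sector_trichotomy (R : realType) (e : R) (q0 q1 q2 : bool -> R) :
  (exists i, e <= `|q0 i|) -> (exists i, e <= `|q1 i|) -> (exists i, e <= `|q2 i|) ->
  (forall i, `|q0 i - q1 i| < e) -> (forall i, `|q1 i - q2 i| < e) ->
  (forall i, `|q0 i - q2 i| < e) ->
  [\/ sector q0 = sector q1, sector q1 = sector q2 | sector q0 = sector q2].
Proof.
move=> h0 h1 h2 d01 d12 d02.
have d10 i : `|q1 i - q0 i| < e by rewrite distrC.
have d21 i : `|q2 i - q1 i| < e by rewrite distrC.
have d20 i : `|q2 i - q0 i| < e by rewrite distrC.
case: (sectorP q0) => -[E0 H0]; case: (sectorP q1) => -[E1 H1];
  case: (sectorP q2) => -[E2 H2]; rewrite E0 E1 E2;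
  try (by constructor 1); try (by constructor 2); try (by constructor 3); exfalso.
- exact: (sector_clash h0 H0.1 H0.2 H1 H2).
- exact: (sector_clash h0 H0.1 H0.2 H2 H1).
- exact: (sector_clash h1 H1.1 H1.2 H0 H2).
- exact: (sector_clash h2 H2.1 H2.2 H0 H1).
- exact: (sector_clash h1 H1.1 H1.2 H2 H0).
- exact: (sector_clash h2 H2.1 H2.2 H1 H0).
Qed.

(** The signed step from [b] to [a] in the cyclic order 0, 1, 2. Steps add up when two of three
    sectors agree; around three different ones they fail by 3. *)
Definition turn (a b : nat) : int :=
  if a == b then 0 else if (a, b) \in [:: (1, 0); (2, 1); (0, 2)]%N then 1 else -1.

Lemma sector_lt3 (R : realType) (q : bool -> R) : (sector q < 3)%N.
Proof. by rewrite /sector; case: ifP => // _; case: ifP. Qed.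

Lemma turn_flat a b c : (a < 3)%N -> (b < 3)%N -> (c < 3)%N ->
  [\/ a = b, b = c | a = c] -> turn b c + turn a b = turn a c.
Proof.
by case: a => [|[|[|//]]]; case: b => [|[|[|//]]]; case: c => [|[|[|//]]] => // _ _ _ [].
Qed.

(** Indices are clamped at [N], so that the finite grid is indexed by all pairs of naturals, as
    [grid_section] expects. *)
Definition grid_pt (R : realType) (a b : R) (N : nat) (c : nat * nat) : bool -> R :=
  fun t => a + (b - a) * ((minn (if t then c.1 else c.2) N)%:R / N%:R).

Lemma grid_pt_box (R : realType) (a b : R) N c : a <= b -> (0 < N)%N ->
  box a b (grid_pt a b N c).
Proof.
move=> ab N0 t; rewrite /grid_pt; set n := minn _ _.
have nN : (n <= N)%N by rewrite geq_minr.
have N0' : 0 < N%:R :> R by rewrite ltr0n.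
have h1 : (n%:R / N%:R : R) <= 1 by rewrite ler_pdivrMr // mul1r ler_nat.
have h0 : 0 <= (n%:R / N%:R : R) by rewrite divr_ge0.
set q := _ / _ in h0 h1 *; apply/andP; split; nra.
Qed.

Lemma grid_pt_near (R : realType) (a b : R) N c c' : a <= b -> (0 < N)%N ->
  near_cells c c' ->
  forall t, `|grid_pt a b N c t - grid_pt a b N c' t| <= (b - a) / N%:R.
Proof.
move=> ab N0 [n1 n2 n3 n4] t; rewrite /grid_pt.
set n := minn (if t then c.1 else _) _; set n' := minn _ _.
have [h1 h2] : (n <= n'.+1)%N /\ (n' <= n.+1)%N.
  by rewrite /n /n'; clear -n1 n2 n3 n4; destruct t; lia.
have N0' : 0 < N%:R :> R by rewrite ltr0n.
rewrite (_ : _ - _ = (b - a) / N%:R * (n%:R - n'%:R)); last by ring.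
have ba : 0 <= (b - a) / N%:R by rewrite divr_ge0 ?subr_ge0 // ltW.
rewrite normrM (ger0_norm ba) ler_piMr // ler_norml.
have e1 : n%:R <= n'%:R + 1 :> R by rewrite natr1 ler_nat.
have e2 : n'%:R <= n%:R + 1 :> R by rewrite natr1 ler_nat.
by apply/andP; split; lra.
Qed.

Lemma fine_mesh (R : realType) (a b d : R) : a <= b -> 0 < d ->
  exists N, (0 < N)%N /\ (b - a) / N%:R < d.
Proof.
move=> ab d0; exists (Num.truncn ((b - a) / d)).+1; split => //.
rewrite ltr_pdivrMr ?ltr0n // mulrC -ltr_pdivrMr //.
exact: truncnS_gt.
Qed.

(** The circle |x| + |y| = 1 run once counterclockwise from (1, 0), with its corners at integer
    s. *)
Definition diamond (R : realType) (s : R) : bool -> R :=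
  fun i => if i then `|s - 2| - 1 else 1 - `|s - 1| + (s - 3) + `|s - 3|.

(** The sector along [diamond], lifted from residues modulo 3 to integers: after one turn it is 3
    and not 0. Only the endpoint 4 is back in the first quadrant, hence the weak inequality
    there. *)
Definition quarter (R : realType) (s : R) : nat :=
  (1 < s)%R + (2 < s)%R + (4 <= s)%R.

Lemma sector_diamond (R : realType) (r s : R) : 0 < r -> 0 <= s -> s <= 4 ->
  sector (fun i => r * diamond s i) = (quarter s %% 3)%N.
Proof.
move=> r0 s0 s4; rewrite /sector /diamond /quarter !pmulr_rlt0 //.
have [s1|s1] := leP s 1.
  rewrite (ltr0_norm (_ : s - 2 < 0)); last lra.
  rewrite (ler0_norm (_ : s - 1 <= 0)); last lra.
  rewrite (ltr0_norm (_ : s - 3 < 0)); last lra.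
  rewrite ltNge (_ : 0 <= _); last lra.
  rewrite ltNge (_ : 0 <= _); last lra.
  rewrite (ltNge 2) (_ : s <= 2) /=; last lra.
  by rewrite leNgt (_ : s < 4) //; lra.
have [s2|s2] := leP s 2.
  rewrite (ler0_norm (_ : s - 2 <= 0)); last lra.
  rewrite (gtr0_norm (_ : 0 < s - 1)); last lra.
  rewrite (ltr0_norm (_ : s - 3 < 0)); last lra.
  rewrite ltNge (_ : 0 <= _); last lra.
  rewrite (_ : _ < 0); last lra.
  by rewrite leNgt (_ : s < 4) //; lra.
rewrite (gtr0_norm (_ : 0 < s - 2)); last lra.
rewrite (gtr0_norm (_ : 0 < s - 1)); last lra.
have [s4'|s4'] := leP 4 s.
  rewrite (gtr0_norm (_ : 0 < s - 3)); last lra.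
  rewrite ltNge (_ : 0 <= _); last lra.
  by rewrite ltNge (_ : 0 <= _); last lra.
rewrite (_ : _ < 0) //.
by have [h|h] := leP s 3; [rewrite ler0_norm|rewrite gtr0_norm]; lra.
Qed.

Lemma turn_quarter (R : realType) (s s' : R) : s <= s' -> s' <= s + 1 ->
  s' <= 4 -> s < 4 ->
  (quarter s')%:Z = (quarter s)%:Z + turn (quarter s' %% 3) (quarter s %% 3).
Proof.
move=> ss' s's s4' s4; rewrite /quarter.
case: (ltP 1 s) => h1; case: (ltP 2 s) => h2; case: (leP 4 s) => h3;
  case: (ltP 1 s') => h1'; case: (ltP 2 s') => h2'; case: (leP 4 s') => h3';
  by rewrite //=; exfalso; lra.
Qed.

Lemma diamond_neq0 (R : realType) (s : R) : 0 <= s -> s <= 4 ->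
  exists i, diamond s i != 0.
Proof.
move=> s0 s4; have [] := eqVneq (diamond s true) 0; last by exists true.
rewrite /diamond => h; exists false; move: h.
case: (ger0P (s - 2)) => h2; rewrite -/(_ != _).
  rewrite (gtr0_norm (_ : 0 < s - 1)); last lra.
  by move=> h; rewrite (ger0_norm (_ : 0 <= s - 3)); [|lra]; apply/eqP; lra.
rewrite (ltr0_norm (_ : s - 3 < 0)); last lra.
by move=> h; rewrite (ger0_norm (_ : 0 <= s - 1)); [|lra]; apply/eqP; lra.
Qed.

Lemma diamond_le1 (R : realType) (s : R) i : 0 <= s -> s <= 4 -> `|diamond s i| <= 1.
Proof.
move=> s0 s4; rewrite /diamond ler_norml.
case: i; [case: (ger0P (s - 2)) => h|case: (ger0P (s - 1)) => h1;
  case: (ger0P (s - 3)) => h3]; apply/andP; split; lra.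
Qed.

Lemma near_cellsr i j : near_cells (i.+1, j) (i, j).
Proof. by split => /=; lia. Qed.

Lemma near_cellsu i j : near_cells (i, j.+1) (i, j).
Proof. by split => /=; lia. Qed.

(** * Small loops that cannot be contracted *)

Section straight_contraction.
Variables (R : realType) (V : finType) (K : simplicial_complex V).
Hypothesis hK : sphere_triangulation R K.
Variables (p p0 b : V -> R) (kappa : R).
Hypotheses (Kp : geom K p) (Kp0 : geom K p0) (pp0 : p <> p0) (kappa0 : 0 < kappa).
Hypothesis contr : forall x, geom K x -> (forall v, `|x v - p v| < kappa) -> x <> p ->
  forall t, 0 <= t -> t <= 1 ->
  let y := fun v => (1 - t) * x v + t * b v in [/\ geom K y, y <> p & y <> p0].

(* A small loop around p would be contracted in the sphere minus p and p0, which
   is a punctured plane in the chart; but it has winding number 1. *)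
Lemma no_straight_contraction : False.
Proof.
have [F [G [cF cG FG GF]]] := plane_chart hK Kp0.
pose z0 := F p.
have Gz0 : G z0 = p by exact: FG.
have [d [d0 dP]] := cG z0 I kappa kappa0.
pose r := d / 2; have r0 : 0 < r by rewrite /r; lra.
pose zeta (s : R) : bool -> R := fun i => z0 i + r * diamond s i.
have zeta_near s v : 0 <= s -> s <= 4 -> `|G (zeta s) v - p v| < kappa.
  move=> s0 s4; rewrite distrC -Gz0; apply: dP => // i; rewrite /zeta distrC addrC addKr.
  rewrite normrM (gtr0_norm r0); have := diamond_le1 i s0 s4 => h.
  by rewrite /r in r0 *; nra.
have zeta_neq s : 0 <= s -> s <= 4 -> G (zeta s) <> p.
  move=> s0 s4 e; have [_ _] := GF (zeta s); rewrite e -/z0 => ez.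
  have [i] := diamond_neq0 s0 s4; apply/negP; rewrite negbK.
  move/(congr1 (fun z => z i)): ez; rewrite /zeta => ez.
  by apply/eqP/(mulfI (lt0r_neq0 r0)); rewrite mulr0; lra.
(* On the square [0, 4]^2 the coordinate [true] runs along the loop, and a quarter of the coordinate
   [false] is the time of the contraction to [b]. *)
pose H (z : bool -> R) : V -> R := fun v =>
  (1 - z false / 4) * G (zeta (z true)) v + z false / 4 * b v.
have HP z : box 0 4 z -> [/\ geom K (H z), H z <> p & H z <> p0].
  move=> bz; have /andP[t0 t4] := bz true; have /andP[f0 f4] := bz false.
  have [Kz _ _] := GF (zeta (z true)).
  have := contr Kz (fun v => zeta_near _ v t0 t4) (zeta_neq _ t0 t4).
  by move=> /(_ (z false / 4)); apply; lra.
pose Q (z : bool -> R) : bool -> R := fun i => F (H z) i - z0 i.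
have cQ : map_cont_on (box 0 4) Q.
  have cz i : cont_on (box 0 4) (fun z : bool -> R => z i) by exact: cont_on_proj.
  have cc (c : R) : cont_on (box 0 4) (fun z : bool -> R => c) by exact: cont_on_cst.
  have cn (c : R) : cont_on (box 0 4) (fun z : bool -> R => `|z true - c|).
    by apply: cont_on_norm; apply: cont_onB.
  have cdi i : cont_on (box 0 4) (fun z : bool -> R => diamond (z true) i).
    case: i; rewrite /diamond; first by apply: cont_onB.
    apply: cont_onD => //; apply: cont_onD; last by apply: cont_onB.
    by apply: cont_onB.
  have cze : map_cont_on (box 0 4) (fun z => zeta (z true)).
    apply: map_cont_on_coord => i; apply: cont_onD => //.
    by apply: cont_onM.
  have cGz : map_cont_on (box 0 4) (fun z => G (zeta (z true))).
    by apply: map_cont_on_comp cG.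
  have cGv v : cont_on (box 0 4) (fun z => G (zeta (z true)) v).
    apply/cont_onP => z bz e e0; have [d' [d'0 d'P]] := cGz z bz e e0.
    by exists d'; split => // y By zy _; exact: d'P.
  have cf4 : cont_on (box 0 4) (fun z : bool -> R => z false / 4) by apply: cont_onM.
  have cH : map_cont_on (box 0 4) H.
    apply: map_cont_on_coord => v; apply: cont_onD; last by apply: cont_onM.
    by apply: cont_onM => //; apply: cont_onB.
  have cFH : map_cont_on (box 0 4) (fun z => F (H z)).
    by apply: map_cont_on_comp cH _ cF => z /HP[].
  move=> z bz e e0; have [d' [d'0 d'P]] := cFH z bz e e0.
  exists d'; split => // y By zy i; rewrite /Q opprB addrA subrK; exact: d'P.
have [eta [eta0 etaP]] : exists e, 0 < e /\ forall z, box 0 4 z ->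
    exists i, e <= `|Q z i|.
  apply: box_covering => [e e' z e'0 ee' [i ei]|z bz].
    by exists i; exact: le_trans ei.
  have [i Qi] : exists i, Q z i != 0.
    apply: contrapT => /forallNP Q0.
    have [Kz zp zp0] := HP z bz; apply: zp; rewrite -(FG _ Kz zp0) -Gz0; congr G.
    by apply/funext => i; apply/eqP; rewrite -subr_eq0; apply/negPn/negP/(Q0 i).
  have Qi0 : 0 < `|Q z i| by rewrite normr_gt0.
  have [e [e0 eP]] := cQ z bz (`|Q z i| / 2) ltac:(lra).
  exists (Num.min e (`|Q z i| / 2)); split; first by rewrite lt_min e0; lra.
  move=> y By zy; exists i; rewrite ge_min; apply/orP; right.
  have : `|Q z i - Q y i| < `|Q z i| / 2.
    by apply: eP => // j; have := zy j; rewrite lt_min => /andP[].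
  have := ler_normB (Q z i) (Q z i - Q y i); rewrite subKr.
  have := ler_normD (Q z i - Q y i) (Q y i); rewrite subrK.
  lra.
have [del [del0 delP]] := box_uniform_cont cQ eta0.
(* A mesh below [del] keeps the images of near grid points within [eta]; a mesh below 1 lets a step
   along the loop enter at most one new sector. *)
have del1 : 0 < Num.min del 1 by rewrite lt_min del0 ltr01.
have [N [N0 Nd]] := @fine_mesh R 0 4 (Num.min del 1) ltac:(lra) del1.
move: Nd; rewrite lt_min => /andP[Nd N1].
have le04 : (0 : R) <= 4 by lra.
pose pt := @grid_pt R 0 4 N.
pose lab c := sector (Q (pt c)).
have ptbox c : box 0 4 (pt c) by exact: grid_pt_box.
have ptnear c c' : near_cells c c' -> forall i, `|Q (pt c) i - Q (pt c') i| < eta.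
  move=> n; apply: delP => // i.
  exact: le_lt_trans (grid_pt_near le04 N0 n i) Nd.
pose T a b (x : int) := x + turn a b.
have [//|||//|k [_ kP]] := @grid_section nat int lab (fun _ _ => True) T 0.
- by move=> y x _; rewrite /T /turn eqxx addr0.
- by [].
- move=> c1 c2 c3 x n12 n23 n13 _; rewrite /T -addrA turn_flat ?sector_lt3 //.
  by apply: sector_trichotomy => //; [exact: etaP|exact: etaP|exact: etaP|
    exact: ptnear|exact: ptnear|exact: ptnear].
have N0' : 0 < N%:R :> R by rewrite ltr0n.
have pt0 i : (i <= N)%N -> pt (i, 0)%N = fun t => if t then 4 * (i%:R / N%:R) else 0.
  move=> iN; apply/funext => -[]; rewrite /pt /grid_pt /=.
    by rewrite (minn_idPl iN) subr0 add0r.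
  by rewrite min0n mul0r mulr0 addr0.
have ptN j : pt (N, j) = fun t => if t then 4 else pt (0%N, j) false.
  apply/funext => -[]; rewrite /pt /grid_pt //=.
  by rewrite minnn divff ?lt0r_neq0 // subr0 add0r mulr1.
have ptT i : pt (i, N) false = 4.
  by rewrite /pt /grid_pt /= minnn divff ?lt0r_neq0 // subr0 add0r mulr1.
have ptF j : pt (0%N, j) true = 0.
  by rewrite /pt /grid_pt /= min0n mul0r mulr0 addr0.
pose s (i : nat) : R := 4 * (i%:R / N%:R).
have s_ge0 i : 0 <= s i by rewrite /s mulr_ge0 // divr_ge0.
have sS i : s i.+1 = s i + 4 / N%:R.
  by rewrite /s -[i.+1%:R]natr1; ring.
have s_lt4 i : (i < N)%N -> s i < 4.
  move=> iN; rewrite /s gtr_pMr ?ltr0n // ltr_pdivrMr // mul1r ltr_nat //.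
have sN : s N = 4 by rewrite /s divff ?lt0r_neq0 // mulr1.
have s_le4 i : (i <= N)%N -> s i <= 4.
  by rewrite leq_eqVlt => /orP[/eqP->|/s_lt4/ltW //]; rewrite sN.
have lab0 i : (i <= N)%N -> lab (i, 0)%N = (quarter (s i) %% 3)%N.
  move=> iN; rewrite -(sector_diamond r0 (s_ge0 i) (s_le4 i iN)).
  congr sector; apply/funext => t; rewrite /Q pt0 //.
  rewrite (_ : H _ = G (zeta (s i))); last first.
    by apply/funext => v; rewrite /H mul0r subr0 mul1r mul0r addr0.
  by have [_ _ ->] := GF (zeta (s i)); rewrite /zeta addrC addKr.
have step0 i : (i < N)%N -> k (i.+1, 0)%N - k (i, 0)%N =
    (quarter (s i.+1))%:Z - (quarter (s i))%:Z.
  move=> iN; rewrite (kP (i.+1, 0)%N (i, 0)%N (near_cellsr i 0)).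
  rewrite /T !lab0 ?(ltnW iN) // (turn_quarter (s := s i)) ?s_le4 ?s_lt4 //; first ring.
    by rewrite sS lerDl divr_ge0 // ltW.
  by rewrite sS lerD2l; move: N1; rewrite subr0 => /ltW.
have row0 i : (i <= N)%N -> k (i, 0)%N - k (0, 0)%N = (quarter (s i))%:Z.
  elim: i => [|i IHi] iN.
    rewrite subrr /s mul0r mulr0 /quarter ltNge ler01 /= ltNge ler0n /=.
    by rewrite leNgt ltr0n.
  rewrite -[LHS](subrKA (k (i, 0)%N)) IHi ?(ltnW iN) // step0 //; ring.
have labN j : lab (N, j) = lab (0%N, j).
  rewrite /lab; congr sector; rewrite /Q; apply/funext => i; congr (F _ i - _).
  apply/funext => v; rewrite /H ptN ptF; congr (_ * G _ v + _).
  apply/funext => t; rewrite /zeta /diamond; congr (_ + r * _).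
  case: t.
    by rewrite sub0r normrN !gtr0_norm //; lra.
  rewrite !sub0r !normrN !gtr0_norm //; lra.
have col j : k (N, j) - k (0%N, j) = k (N, 0)%N - k (0, 0)%N.
  elim: j => [//|j IHj].
  rewrite (kP (N, j.+1) (N, j) (near_cellsu N j)).
  rewrite (kP (0%N, j.+1) (0%N, j) (near_cellsu 0 j)).
  by rewrite /T !labN -IHj; ring.
have labT i : lab (i, N) = lab (0%N, N).
  rewrite /lab; congr sector; rewrite /Q; apply/funext => t; congr (F _ t - _).
  by apply/funext => v; rewrite /H !ptT divff ?subrr ?mul0r // pnatr_eq0.
have top i : k (i, N) = k (0%N, N).
  elim: i => [//|i <-]; rewrite (kP (i.+1, N) (i, N) (near_cellsr i N)).
  by rewrite /T !labT /turn eqxx addr0.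
(* The bottom side contributes 3. The left and right sides cancel because the loop closes, and the
   top is constant, so the same difference is 0. *)
have := row0 N (leqnn N); rewrite -(col N) top subrr sN /quarter lexx.
have -> : (1 < 4 :> R) = true by lra.
by have -> : (2 < 4 :> R) = true by lra.
Qed.

End straight_contraction.

(** * Local structure of the triangulation *)

Section simplices_facts.
Variables (V : finType) (K : simplicial_complex V).

Lemma simplexW (s t : {set V}) : s \in simplices K -> t \subset s ->
  t != finset.set0 -> t \in simplices K.
Proof. by case: K => S h0 h1 h2 /=; exact: h2. Qed.

Lemma simplex1 v : [set v]%SET \in simplices K.
Proof. by case: K. Qed.

Lemma simplexW_mem (s t : {set V}) v : s \in simplices K -> t \subset s ->
  v \in t -> t \in simplices K.
Proof. by move=> sK ts vt; apply: simplexW ts _ => //; apply/set0Pn; exists v. Qed.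

End simplices_facts.

(** * Barycentric coordinates and supports *)

Section barycentric.
Variables (R : realType) (V : finType).
Implicit Types (x y : V -> R) (s : {set V}).

Definition bary s x : Prop :=
  [/\ forall v, 0 <= x v, \sum_v x v = 1 & forall v, v \notin s -> x v = 0].

Definition delta (u : V) : V -> R := fun v => (v == u)%:R.

Lemma delta_id u : delta u u = 1.
Proof. by rewrite /delta eqxx. Qed.

Lemma delta_off u v : v != u -> delta u v = 0.
Proof. by rewrite /delta => /negPf ->. Qed.

Lemma bary_delta s u : u \in s -> bary s (delta u).
Proof.
move=> us; split=> [v||v vs]; rewrite /delta ?ler0n //.
  rewrite (bigD1 u) //= eqxx big1 ?addr0 // => v /negPf ->//.
by case: eqP vs => // ->; rewrite us.
Qed.

Lemma baryW s s' x : s \subset s' -> bary s x -> bary s' x.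
Proof.
move=> ss [x0 x1 xs]; split => // v vs'; apply: xs.
by apply: contra vs'; exact: (fintype.subsetP ss).
Qed.

Lemma bary_convex s x y t : bary s x -> bary s y -> 0 <= t -> t <= 1 ->
  bary s (fun v => (1 - t) * x v + t * y v).
Proof.
move=> [x0 x1 xs] [y0 y1 ys] t0 t1; split=> [v||v vs].
- by rewrite addr_ge0 // mulr_ge0 // subr_ge0.
- by rewrite big_split /= -!mulr_sumr x1 y1; ring.
- by rewrite xs // ys // !mulr0 addr0.
Qed.

Lemma bary1 u x : bary [set u]%SET x -> x = delta u.
Proof.
move=> [x0 x1 xs]; apply/funext => v; rewrite /delta.
have [->|vu] := eqVneq v u; last by apply: xs; rewrite inE.
by rewrite -x1 (bigD1 u) //= big1 ?addr0 // => w wu; apply: xs; rewrite inE.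
Qed.

Lemma delta_neq u v : u != v -> delta u <> delta v.
Proof.
move=> uv /(congr1 (fun x => x u)); rewrite /delta eqxx (negPf uv) => /eqP.
by rewrite oner_eq0.
Qed.

Variable K : simplicial_complex V.

Lemma geom_bary s x : s \in simplices K -> bary s x -> geom K x.
Proof.
move=> sK [x0 x1 xs]; split => //.
have [v xv] : exists v, x v != 0.
  apply: contrapT => /forallNP h; move: x1; rewrite big1 => [/eqP|v _].
    by rewrite eq_sym oner_eq0.
  by apply/eqP/negPn/negP/h.
apply: (simplexW_mem sK (v := v)); last by rewrite inE.
by apply/fintype.subsetP => w; rewrite inE; apply: contraR => /xs ->.
Qed.

Definition supp x : {set V} := [set v | x v != 0]%SET.

Lemma bary_supp x : geom K x -> bary (supp x) x.
Proof. by move=> [x0 x1 _]; split => // v; rewrite inE negbK => /eqP. Qed.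

Lemma supp_gt0 x v : 0 < x v -> v \in supp x.
Proof. by move=> xv; rewrite inE gt_eqF. Qed.

Lemma supp_simplex x : geom K x -> supp x \in simplices K.
Proof. by case. Qed.

Lemma geom_simplex2 x u v : geom K x -> u \in supp x -> v \in supp x ->
  [set u; v]%SET \in simplices K.
Proof.
move=> Kx ux vx; apply: (simplexW_mem (supp_simplex Kx) (v := u)).
  by rewrite finset.subUset !finset.sub1set ux.
by rewrite !inE eqxx.
Qed.

Lemma geom_simplex3 x u v w : geom K x -> u \in supp x -> v \in supp x ->
  w \in supp x -> [set u; v; w]%SET \in simplices K.
Proof.
move=> Kx ux vx wx; apply: (simplexW_mem (supp_simplex Kx) (v := u)).
  by rewrite !finset.subUset !finset.sub1set ux vx.
by rewrite !inE eqxx.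
Qed.

End barycentric.

(** The segment is treated through the coordinate [true] of the square in [box_covering]. *)
Lemma locally_constant_segment (R : realType) (Q : R -> Prop) :
  (forall t, 0 <= t <= 1 -> exists e, 0 < e /\ forall t', 0 <= t' <= 1 ->
     `|t - t'| < e -> (Q t <-> Q t')) -> Q 0 -> Q 1.
Proof.
move=> Qloc.
have [e [e0 eP]] : exists e : R, 0 < e /\ forall z : bool -> R, box 0 1 z ->
    forall t', 0 <= t' <= 1 -> `|z true - t'| < e -> (Q (z true) <-> Q t').
  apply: box_covering => [d d' z d'0 dd' h t' t'01 zt'|z bz].
    by apply: h => //; exact: lt_le_trans dd'.
  have [e [e0 eP]] := Qloc _ (bz true).
  exists (e / 2); split; first lra.
  move=> y By zy t' t'01 yt'.
  have := zy true; move: yt'; rewrite !ltr_norml => /andP[? ?] /andP[? ?].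
  rewrite -(eP (y true)) ?By //; last by rewrite ltr_norml; apply/andP; split; lra.
  by rewrite -(eP t') //; rewrite ltr_norml; apply/andP; split; lra.
have [N [N0 Ne]] := @fine_mesh R 0 1 e ler01 e0.
have N0' : 0 < N%:R :> R by rewrite ltr0n.
move=> Q0; have : forall i, (i <= N)%N -> Q (i%:R / N%:R).
  elim=> [|i IHi] iN; first by rewrite mul0r.
  have in01 j : (j <= N)%N -> 0 <= (j%:R / N%:R : R) <= 1.
    by move=> jN; rewrite divr_ge0 //= ler_pdivrMr // mul1r ler_nat.
  rewrite -(eP (fun=> i%:R / N%:R)) //; first by apply: IHi; exact: ltnW.
  - by move=> b; apply: in01; exact: ltnW.
  - exact: in01.
  rewrite -natr1 mulrDl opprD addrA subrr sub0r normrN ger0_norm.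
    by move: Ne; rewrite subr0.
  by rewrite divr_ge0 // ltW.
by move=> /(_ N (leqnn N)); rewrite divff // lt0r_neq0.
Qed.

Lemma convex_gt0 (R : realType) (a b t : R) : 0 < a -> 0 < b -> 0 <= t -> t <= 1 ->
  0 < (1 - t) * a + t * b.
Proof. by move=> a0 b0 t0 t1; have [tn0|tn0] := ltP 0 t; nra. Qed.

(** * Connectedness of links *)

Section surface.
Variables (R : realType) (V : finType) (K : simplicial_complex V).
Hypothesis hK : sphere_triangulation R K.

Lemma geom_delta v : geom K (@delta R V v).
Proof. by apply: geom_bary (simplex1 K v) _; apply: bary_delta; rewrite inE. Qed.

(** If no face at v joined [A] to its complement, a punctured square around v in the chart would
    split into two nonempty open parts, according to the vertices other than v in the supports. *)
Lemma link_connected (v u w : V) (A : V -> Prop) : u != v -> w != v ->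
  [set v; u]%SET \in simplices K -> [set v; w]%SET \in simplices K ->
  A u -> ~ A w ->
  exists a b, [/\ a != v, b != v, A a, ~ A b & [set v; a; b]%SET \in simplices K].
Proof.
move=> uv wv Kvu Kvw Au nAw; apply: contrapT => nosplit.
have Kp := geom_delta v; set p := delta R v in Kp.
have pp0 : p <> delta R u by apply: delta_neq; rewrite eq_sym.
have [F [G [cF cG FG GF]]] := plane_chart hK (geom_delta u).
pose z0 := F p.
have Gz0 : G z0 = p by exact: FG.
(* Within 1/2 of the vertex, the coordinate at v stays positive, so v belongs to every support. *)
have [d [d0 dP]] := cG z0 I (1 / 2) ltac:(lra).
pose D (z : bool -> R) := (forall i, `|z0 i - z i| < d) /\ z <> z0.
have GP z : G z = p -> z = z0 by move=> e; have [_ _ <-] := GF z; rewrite e.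
have Gv z : D z -> v \in supp (G z).
  move=> [zd _]; apply: supp_gt0.
  have := dP z I zd v; rewrite Gz0 /p delta_id ltr_norml => /andP[_ ?]; lra.
pose inA z := exists a, [/\ a != v, A a & a \in supp (G z)].
pose inB z := exists a, [/\ a != v, ~ A a & a \in supp (G z)].
have AorB z : D z -> inA z \/ inB z.
  move=> Dz; have [Kz _ _] := GF z.
  have [a [av az]] : exists a, a != v /\ a \in supp (G z).
    apply: contrapT => h; apply: Dz.2; apply: GP; apply: bary1.
    case: (bary_supp Kz) => z1 z2 z3; split => // a; rewrite inE => av.
    by apply: z3; apply/negP => az; apply: h; exists a.
  by have [?|?] := pselect (A a); [left|right]; exists a.
have nAB z : D z -> inA z -> inB z -> False.
  move=> Dz [a [av Aa az]] [b [bv Ab bz]]; apply: nosplit; exists a, b; split => //.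
  by have [Kz _ _] := GF z; apply: (geom_simplex3 Kz) => //; exact: Gv.
have supp_near z a : a \in supp (G z) -> exists e, 0 < e /\
    forall y, (forall i, `|z i - y i| < e) -> a \in supp (G y).
  move=> az; have [[z1 _ _] _ _] := GF z.
  have Gza : 0 < G z a by rewrite lt_def z1 andbT; move: az; rewrite inE.
  have [e [e0 eP]] := cG z I (G z a) Gza; exists e; split => // y zy.
  by apply: supp_gt0; have := eP y I zy a; rewrite ltr_norml => /andP[_]; lra.
(* The part of the square on one side of the line where coordinate i equals [z0 i] is convex and
   misses [z0]; [sg] tells the side. *)
have half z1 z2 i (sg : bool) : D z1 -> D z2 ->
    0 < (-1) ^+ sg * (z1 i - z0 i) -> 0 < (-1) ^+ sg * (z2 i - z0 i) -> inA z1 -> inA z2.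
  move=> D1 D2 p1 p2.
  pose c (t : R) : bool -> R := fun i => (1 - t) * z1 i + t * z2 i.
  have cD t : 0 <= t <= 1 -> D (c t).
    move=> /andP[t0 t1]; split => [j|].
      move: (D1.1 j) (D2.1 j); rewrite /c !ltr_norml.
      move=> /andP[l1 u1] /andP[l2 u2].
      have := @convex_gt0 _ (d - (z0 j - z1 j)) (d - (z0 j - z2 j)) t ltac:(lra) ltac:(lra) t0 t1.
      have := @convex_gt0 _ (d + (z0 j - z1 j)) (d + (z0 j - z2 j)) t ltac:(lra) ltac:(lra) t0 t1.
      by move=> ? ?; apply/andP; split; lra.
    move/(congr1 (fun z => z i)); rewrite /c => e.
    suff : 0 < (-1) ^+ sg * (c t i - z0 i) by rewrite /c e subrr mulr0 ltxx.
    rewrite (_ : _ * _ = (1 - t) * ((-1) ^+ sg * (z1 i - z0 i)) +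
      t * ((-1) ^+ sg * (z2 i - z0 i))); last by rewrite /c; ring.
    exact: convex_gt0.
  have -> : z1 = c 0 by apply/funext => j; rewrite /c; ring.
  have -> : z2 = c 1 by apply/funext => j; rewrite /c; ring.
  apply: (locally_constant_segment (Q := fun t => inA (c t))) => t t01.
  have [a [av az Aa]] : exists a, [/\ a != v, a \in supp (G (c t)) & A a <-> inA (c t)].
    have [/[dup] At [a [av Aa az]]|/[dup] Bt [a [av Aa az]]] := AorB _ (cD t t01).
      by exists a.
    by exists a; split => //; split => // At; case: (nAB _ (cD t t01) At Bt).
  have [e [e0 eP]] := supp_near _ _ az.
  pose M := 1 + \sum_j `|z1 j - z2 j|.
  have M0 : 0 < M by rewrite ltr_pwDl // sumr_ge0.
  exists (e / M); split; first by rewrite divr_gt0.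
  move=> t' t'01 tt'.
  have az' : a \in supp (G (c t')).
    apply: eP => j; rewrite /c (_ : _ - _ = (t - t') * (z2 j - z1 j)); last ring.
    have le : `|z2 j - z1 j| <= M.
      by rewrite /M (bigD1 j) //= distrC addrCA lerDl addr_ge0 // sumr_ge0.
    rewrite normrM; move: tt'; rewrite ltr_pdivlMr // => tt'.
    apply: le_lt_trans tt'; exact: ler_wpM2l.
  rewrite -Aa; split=> [?|[b [bv Ab bz]]]; first by exists a.
  apply: contrapT => nAa; apply: (nAB _ (cD t' t'01)); first by exists b.
  by exists a.
(* Adjacent corners lie in a common half, and every point of [D] shares a half with some corner; so
   the four halves connect the punctured square. *)
pose corner (s1 s2 : bool) : bool -> R :=
  fun i => z0 i + (-1) ^+ (if i then s1 else s2) * (d / 2).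
have cornerP (s1 s2 i : bool) : 0 < (-1) ^+ (if i then s1 else s2) * (corner s1 s2 i - z0 i).
  rewrite /corner [z0 i + _]addrC addrK mulrA -expr2 sqrr_sign mul1r; lra.
have cornerD s1 s2 : D (corner s1 s2).
  split=> [i|/(congr1 (fun z => z true)) e]; last first.
    by have := cornerP s1 s2 true; rewrite e subrr mulr0 ltxx.
  rewrite /corner opprD addrA subrr sub0r normrN normrM normrX normrN1 expr1n mul1r.
  by rewrite gtr0_norm; lra.
have cc s1 s2 t1 t2 : inA (corner s1 s2) -> inA (corner t1 t2).
  move=> h; have h' : inA (corner s1 t2).
    exact: (half _ _ true s1 _ _ (cornerP s1 s2 true) (cornerP s1 t2 true) h).
  exact: (half _ _ false t2 _ _ (cornerP s1 t2 false) (cornerP t1 t2 false) h').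
have toc z : D z -> exists s1 s2, inA z <-> inA (corner s1 s2).
  move=> Dz; have [i zi] : exists i, z i - z0 i != 0.
    apply: contrapT => /forallNP h; apply: Dz.2; apply/funext => i.
    by apply/eqP; rewrite -subr_eq0; apply/negPn/negP/h.
  pose sg := z i - z0 i < 0.
  have sgP : 0 < (-1) ^+ sg * (z i - z0 i).
    rewrite /sg; case: (ltP (z i - z0 i) 0) => h.
      by rewrite expr1 mulN1r oppr_gt0.
    by rewrite expr0 mul1r lt_def zi.
  exists sg, sg; have := cornerP sg sg i; rewrite if_same => cP.
  by split; apply: half sgP _ || apply: half _ sgP.
have allA z1 z2 : D z1 -> D z2 -> inA z1 -> inA z2.
  move=> /toc[s1 [s2 e1]] /toc[t1 [t2 e2]].
  by rewrite e1 e2; exact: cc.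
have [d' [d'0 d'P]] := cF p (conj Kp pp0) d d0.
(* The witness is the image of a point of the edge va, close enough to v to land in the square. *)
have spoke a : a != v -> [set v; a]%SET \in simplices K ->
    exists z, D z /\ a \in supp (G z).
  move=> av Kva; pose t := Num.min d' 1 / 2.
  have [t0 [t1 t2]] : 0 < t /\ t < 1 /\ t < d'.
    have h1 : Num.min d' 1 <= d' by rewrite ge_min lexx.
    have h2 : Num.min d' 1 <= 1 by rewrite ge_min lexx orbT.
    have h0 : 0 < Num.min d' 1 by rewrite lt_min d'0 ltr01.
    by rewrite /t; split; [|split]; lra.
  pose x := fun b => (1 - t) * p b + t * delta R a b.
  have Kx : geom K x.
    apply: (geom_bary Kva); apply: bary_convex; [| |lra|lra].
      by apply: bary_delta; rewrite !inE eqxx.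
    by apply: bary_delta; rewrite !inE eqxx orbT.
  have xa : x a = t by rewrite /x /p delta_id delta_off //; ring.
  have xv : x v = 1 - t.
    by rewrite /x /p delta_id delta_off 1?eq_sym //; ring.
  have xp0 : x <> delta R u.
    move=> e; have := xv; rewrite e delta_off 1?eq_sym // => h; clear -t1 h; lra.
  have GFx := FG x Kx xp0.
  exists (F x); split; last by rewrite GFx; apply: supp_gt0; rewrite xa.
  split=> [i|e]; last first.
    have : x = p by rewrite -GFx e.
    by move/(congr1 (fun y => y v)); rewrite xv /p delta_id => h; clear -t0 h; lra.
  apply: d'P => // b; rewrite /x (_ : _ - _ = t * (p b - delta R a b)); last ring.
  rewrite normrM (gtr0_norm t0); apply: le_lt_trans t2; rewrite ler_piMr //; first exact: ltW.
  rewrite /p /delta; case: eqP => _; case: eqP => _;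
    by rewrite ?subrr ?subr0 ?sub0r ?normrN ?normr0 ?normr1.
have [zu [Du zuP]] := spoke u uv Kvu.
have [zw [Dw zwP]] := spoke w wv Kvw.
apply: (nAB zw Dw); last by exists w.
by apply: (allA zu) => //; exists u.
Qed.

End surface.

(** * Faces around an edge *)

Section edges.
Variables (R : realType) (V : finType) (K : simplicial_complex V).
Hypothesis hK : sphere_triangulation R K.

(** If uv were in no face, v would be the only neighbour of u by [link_connected]. The points near
    u, other than u, would then be inside the edge and could be pushed to its midpoint without
    meeting u. *)
Lemma edge_in_face (u v : V) : u != v -> [set u; v]%SET \in simplices K ->
  exists w, [/\ w != u, w != v & [set u; v; w]%SET \in simplices K].
Proof.
move=> uv Kuv; apply: contrapT => noface.
have only a : a != u -> [set u; a]%SET \in simplices K -> a = v.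
  move=> au Kua; apply: contrapT => av.
  have vu : v != u by rewrite eq_sym.
  have [a' [b [_ bu -> bv Kuvb]]] :=
    link_connected (A := fun c => c = v) hK vu au Kuv Kua erefl av.
  by apply: noface; exists b; split => //; apply/eqP.
pose b := fun c => (1 - 1 / 2) * delta R u c + 1 / 2 * delta R v c.
have buv (s : {set V}) : u \in s -> v \in s -> bary s b.
  move=> us vs; apply: bary_convex; [exact: bary_delta|exact: bary_delta|lra|lra].
have bu : b u = 1 / 2 by rewrite /b delta_id delta_off //; lra.
have bv : b v = 1 / 2 by rewrite /b delta_id delta_off 1?eq_sym //; lra.
apply: (@no_straight_contraction R V K hK (delta R u) (delta R v) b (1 / 2)).
- exact: geom_delta.
- exact: geom_delta.
- exact: delta_neq.
- by rewrite divr_gt0.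
move=> x Kx xu xneq t t0 t1 y.
have xu_gt : 0 < x u.
  by have := xu u; rewrite delta_id ltr_norml => /andP[h _]; clear -h; lra.
have bx : bary [set u; v]%SET x.
  apply: baryW (bary_supp Kx); apply/fintype.subsetP => c cx.
  have [->|cu] := eqVneq c u; first by rewrite !inE eqxx.
  by rewrite (only c) ?inE ?eqxx ?orbT // (geom_simplex2 Kx) // supp_gt0.
have xv_gt : 0 < x v.
  case: (bx) => x0 _ xs; rewrite lt_def x0 andbT; apply/eqP => xv0; apply: xneq.
  apply: bary1; case: (bx) => ? ? _; split => // c; rewrite inE => cu.
  have [->//|cv] := eqVneq c v.
  by apply: xs; rewrite !inE negb_or cu.
have yu : 0 < y u by apply: convex_gt0 => //; rewrite bu divr_gt0.
have yv : 0 < y v by apply: convex_gt0 => //; rewrite bv divr_gt0.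
split.
- apply: geom_bary Kuv _; apply: bary_convex => //; apply: buv; rewrite !inE eqxx ?orbT //.
- by move=> e; move: yv; rewrite e delta_off 1?eq_sym // ltxx.
- by move=> e; move: yu; rewrite e delta_off // ltxx.
Qed.

(** With a single face uvw on the edge, the points near its midpoint [p] fill a half-disc, which
    contracts to the interior point [b]: the coordinate at w becomes positive as soon as the
    contraction starts, so [p] is avoided. *)
Lemma edge_in_two_faces (u v : V) : u != v -> [set u; v]%SET \in simplices K ->
  exists w w', [/\ w != w', w != u /\ w != v, w' != u /\ w' != v,
    [set u; v; w]%SET \in simplices K & [set u; v; w']%SET \in simplices K].
Proof.
move=> uv Kuv; have [w [wu wv Kuvw]] := edge_in_face uv Kuv.
apply: contrapT => nosecond.
have only a : a != u -> a != v -> [set u; v; a]%SET \in simplices K -> a = w.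
  move=> au av Kuva; apply: contrapT => aw; apply: nosecond; exists w, a; split => //.
  by apply/eqP => e; apply: aw.
pose p := fun c => (1 - 1 / 2) * delta R u c + 1 / 2 * delta R v c.
pose b := fun c => (1 - 1 / 4) * p c + 1 / 4 * delta R w c.
have puv (s : {set V}) : u \in s -> v \in s -> bary s p.
  by move=> us vs; apply: bary_convex; [exact: bary_delta|exact: bary_delta|lra|lra].
have pu : p u = 1 / 2 by rewrite /p delta_id delta_off //; lra.
have pv : p v = 1 / 2 by rewrite /p delta_id delta_off 1?eq_sym //; lra.
have pw : p w = 0 by rewrite /p !delta_off //; lra.
have bu : b u = 3 / 8 by rewrite /b pu delta_off 1?eq_sym //; lra.
have bv : b v = 3 / 8 by rewrite /b pv delta_off 1?eq_sym //; lra.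
have bw : b w = 1 / 4 by rewrite /b pw delta_id; lra.
have buvw : bary [set u; v; w]%SET b.
  apply: bary_convex; [|by apply: bary_delta; rewrite !inE eqxx orbT|lra|lra].
  by apply: puv; rewrite !inE eqxx ?orbT.
apply: (@no_straight_contraction R V K hK p (delta R u) b (1 / 4)).
- by apply: geom_bary Kuv _; apply: puv; rewrite !inE eqxx ?orbT.
- exact: geom_delta.
- move=> /(congr1 (fun x => x v)); rewrite pv delta_off 1?eq_sym // => /eqP.
  by rewrite mulf_eq0 oner_eq0 invr_eq0 pnatr_eq0.
- by rewrite divr_gt0.
move=> x Kx xp xneq t t0 t1 y.
have xu_gt : 0 < x u.
  by have := xp u; rewrite pu ltr_norml => /andP[h _]; clear -h; lra.
have xv_gt : 0 < x v.
  by have := xp v; rewrite pv ltr_norml => /andP[h _]; clear -h; lra.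
have bx : bary [set u; v; w]%SET x.
  apply: baryW (bary_supp Kx); apply/fintype.subsetP => c cx.
  have [->|cu] := eqVneq c u; first by rewrite !inE eqxx.
  have [->|cv] := eqVneq c v; first by rewrite !inE eqxx orbT.
  by rewrite (only c) ?inE ?eqxx ?orbT // (geom_simplex3 Kx) // supp_gt0.
have yv : 0 < y v by apply: convex_gt0 => //; rewrite bv divr_gt0.
split.
- by apply: geom_bary Kuvw _; exact: bary_convex.
- move=> e; have yw : y w = 0 by rewrite e pw.
  have t_0 : t = 0.
    have xw : 0 <= x w by case: bx.
    by move: yw; rewrite /y bw => h; clear -h xw t0 t1; nra.
  by apply: xneq; rewrite -e; apply/funext => c; rewrite /y t_0; ring.
- by move=> e; move: yv; rewrite e delta_off 1?eq_sym // ltxx.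
Qed.

End edges.

(** * Monodromy *)

Section cells.
Variables (R : realType) (B : R) (N : nat).
Hypotheses (B0 : 0 < B) (N0 : (0 < N)%N).

Let mesh : R := (B + B) / N%:R.

Let N0' : 0 < N%:R :> R. Proof. by rewrite ltr0n. Qed.

Let mesh0 : 0 < mesh. Proof. by rewrite divr_gt0 // addr_gt0. Qed.

Definition cell (z : bool -> R) : nat * nat :=
  (Num.truncn ((z true + B) / ((B + B) / N%:R)),
   Num.truncn ((z false + B) / ((B + B) / N%:R))).

Lemma cell_pt_near (z : bool -> R) : box (- B) B z ->
  forall i, `|z i - grid_pt (- B) B N (cell z) i| <= (B + B) / N%:R.
Proof.
move=> bz i; rewrite -/mesh /grid_pt.
rewrite (_ : (if i then _ else _) = Num.truncn ((z i + B) / mesh)); last by case: i.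
have /andP[z1 z2] := bz i; set y := (z i + B) / mesh.
have zy : z i = - B + mesh * y by rewrite /y mulrC divfK ?gt_eqF //; lra.
have y0 : 0 <= y by rewrite divr_ge0 ?(ltW mesh0) //; lra.
have [l u] : (Num.truncn y)%:R <= y /\ y < (Num.truncn y).+1%:R.
  by have /andP[] := truncn_itv y0.
rewrite -natr1 in u.
have yN : y <= N%:R.
  rewrite ler_pdivrMr // /mesh mulrC divfK ?gt_eqF //; lra.
have -> : minn (Num.truncn y) N = Num.truncn y.
  by apply/minn_idPl; rewrite -(ler_nat R); exact: le_trans l yN.
rewrite {1}zy opprK (_ : (B + B) * _ = mesh * (Num.truncn y)%:R); last first.
  by rewrite /mesh; ring.
set n : R := _%:R in l u *.
rewrite (_ : _ - _ = mesh * (y - n)); last ring.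
rewrite ger0_norm ?mulr_ge0 ?subr_ge0 ?(ltW mesh0) //; last by rewrite addr_ge0 ?ltW.
by rewrite ler_piMr ?(ltW mesh0) // lerBlDr addrC ltW.
Qed.

Lemma cell_near (z z' : bool -> R) : box (- B) B z -> box (- B) B z' ->
  (forall i, `|z i - z' i| < (B + B) / N%:R) -> near_cells (cell z) (cell z').
Proof.
have one (a b : R) : - B <= a -> - B <= b -> `|a - b| < mesh ->
    (Num.truncn ((a + B) / mesh) <= (Num.truncn ((b + B) / mesh)).+1)%N.
  move=> ha hb; rewrite ltr_norml => /andP[_ ab].
  have a0 : 0 <= (a + B) / mesh by rewrite divr_ge0 ?(ltW mesh0) //; lra.
  have b0 : 0 <= (b + B) / mesh by rewrite divr_ge0 ?(ltW mesh0) //; lra.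
  have /andP[l _] := truncn_itv a0; have /andP[_ u] := truncn_itv b0.
  have h : (a + B) / mesh < (b + B) / mesh + 1.
    by rewrite -(divff (lt0r_neq0 mesh0)) -mulrDl ltr_pM2r ?invr_gt0 //; lra.
  rewrite -ltnS -(ltr_nat R) -[X in _ < X]natr1.
  by apply: le_lt_trans l _; apply: lt_trans h _; rewrite ltrD2r.
move=> bz bz' zz'; have /andP[t1 _] := bz true; have /andP[f1 _] := bz false.
have /andP[t1' _] := bz' true; have /andP[f1' _] := bz' false.
have z'z i : `|z' i - z i| < mesh by rewrite distrC; exact: zz'.
by split; [exact: (one _ _ t1 t1' (zz' true))|exact: (one _ _ t1' t1 (z'z true))
  |exact: (one _ _ f1 f1' (zz' false))|exact: (one _ _ f1' f1 (z'z false))].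
Qed.

End cells.

Section monodromy.
Variables (R : realType) (V : finType) (K : simplicial_complex V).
Hypothesis hK : sphere_triangulation R K.

Definition seg (u v : V) (t : R) : V -> R :=
  fun c => (1 - t) * delta R u c + t * delta R v c.

Lemma bary_seg u v t : 0 <= t <= 1 -> bary [set u; v]%SET (seg u v t).
Proof.
move=> /andP[t0 t1]; apply: bary_convex => //; apply: bary_delta;
  by rewrite !inE eqxx ?orbT.
Qed.

Lemma seg_cont u v :
  map_cont_on (box 0 1) (fun z : bool -> R => seg u v (z true)).
Proof.
apply: map_cont_on_coord => c; apply: cont_onD; apply: cont_onM;
  do ?exact: cont_on_cst; last exact: cont_on_proj.
by apply: cont_onB; [exact: cont_on_cst|exact: cont_on_proj].
Qed.

(** The chart is punctured at the barycentre of a face, off all edges, so the image of the whole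
    1-skeleton is bounded and fits into one square. *)
Lemma seg_chart (u0 v0 : V) : u0 != v0 -> [set u0; v0]%SET \in simplices K ->
  exists (F : (V -> R) -> (bool -> R)) (G : (bool -> R) -> (V -> R)) (B : R),
  [/\ 0 < B, map_cont_on (fun=> True) G, forall z, geom K (G z)
    & forall u v, [set u; v]%SET \in simplices K ->
      [/\ map_cont_on (box 0 1) (fun z : bool -> R => F (seg u v (z true)))
        & forall t, 0 <= t <= 1 ->
          G (F (seg u v t)) = seg u v t /\ box (- B) B (F (seg u v t))]].
Proof.
move=> uv0 Kuv0; have [w0 [wu0 wv0 Kuvw0]] := edge_in_face hK uv0 Kuv0.
pose p0 := fun c => (1 - 1 / 3) * seg u0 v0 (1 / 2) c + 1 / 3 * delta R w0 c.
have half01 : 0 <= (1 / 2 : R) <= 1 by apply/andP; split; lra.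
have Kp0 : geom K p0.
  apply: (geom_bary Kuvw0); apply: bary_convex; [| |lra|lra].
    by apply: baryW (bary_seg u0 v0 half01); apply/fintype.subsetP => c; rewrite !inE => ->.
  by apply: bary_delta; rewrite !inE eqxx orbT.
have [F [G [cF cG FG GF]]] := plane_chart hK Kp0.
have third : (1 / 3 : R) <> 0 by apply/eqP; rewrite gt_eqF // divr_gt0.
have hu : p0 u0 <> 0.
  by rewrite /p0 /seg delta_id !delta_off // 1?eq_sym // (_ : _ + _ = 1 / 3) //; field.
have hv : p0 v0 <> 0.
  by rewrite /p0 /seg delta_id !delta_off // 1?eq_sym // (_ : _ + _ = 1 / 3) //; field.
have hw : p0 w0 <> 0.
  by rewrite /p0 /seg delta_id !delta_off // (_ : _ + _ = 1 / 3) //; field.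
have seg_p0 u v t : 0 <= t <= 1 -> seg u v t <> p0.
  move=> t01 e; have [_ _ h] := bary_seg u v t01; rewrite e in h.
  have mem c : p0 c <> 0 -> c = u \/ c = v.
    by move=> pc; have [/set2P //|/h //] := boolP (c \in [set u; v]%SET).
  by move: uv0 wu0 wv0; case: (mem u0 hu) => ->; case: (mem v0 hv) => ->;
    case: (mem w0 hw) => ->; rewrite ?eqxx.
have cFs u v : [set u; v]%SET \in simplices K ->
    map_cont_on (box 0 1) (fun z : bool -> R => F (seg u v (z true))).
  move=> Kuv; apply: (map_cont_on_comp (seg_cont u v) _ cF) => z bz; split.
    exact: geom_bary Kuv (bary_seg u v (bz true)).
  exact: seg_p0 (bz true).
have bound (uv : V * V) : exists b, 0 < b /\ ([set uv.1; uv.2]%SET \in simplices K ->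
    forall t, 0 <= t <= 1 -> forall i, `|F (seg uv.1 uv.2 t) i| <= b).
  have [Kuv|] := boolP ([set uv.1; uv.2]%SET \in simplices K); last by exists 1.
  (* The bound is the inverse radius, so that the property passes to smaller radii. *)
  have [d [d0 dP]] : exists d : R, 0 < d /\ forall z : bool -> R, box 0 1 z ->
      forall i, `|F (seg uv.1 uv.2 (z true)) i| <= d^-1.
    apply: box_covering => [d d' z d'0 dd' h i|z bz].
      apply: le_trans (h i) _; rewrite lef_pV2 //; exact: lt_le_trans dd'.
    have [d [d0 dP]] := cFs _ _ Kuv z bz 1 ltr01.
    pose f := F (seg uv.1 uv.2 (z true)).
    pose M : R := 1 + `|f true| + `|f false|.
    have M0 : 0 < M by rewrite /M -addrA ltr_pwDl // addr_ge0.
    exists (Num.min d M^-1); split; first by rewrite lt_min d0 invr_gt0.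
    move=> y By zy i.
    have zy' j : `|z j - y j| < d by have := zy j; rewrite lt_min => /andP[].
    have := dP y By zy' i; rewrite -/f distrC => h.
    have fi : `|f i| <= M - 1.
      by rewrite /M; case: (i); rewrite ?addrK; [have := normr_ge0 (f false)
        |have := normr_ge0 (f true)] => ?; lra.
    have h2 : `|F (seg uv.1 uv.2 (y true)) i| <= M.
      rewrite -[F _ i](subrK (f i)); apply: le_trans (ler_normD _ _) _; lra.
    apply: le_trans h2 _; rewrite -[M in leLHS]invrK lef_pV2 ?posrE ?invr_gt0 //.
      by rewrite ge_min lexx orbT.
    by rewrite lt_min d0 invr_gt0.
  exists d^-1; split; first by rewrite invr_gt0.
  by move=> _ t t01 i; apply: (dP (fun=> t)).
have [b bP] := choice bound.
have b0 uv : 0 <= b uv by case: (bP uv) => /ltW.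
exists F, G, (1 + \sum_uv b uv); split => //.
- by rewrite ltr_pwDl // sumr_ge0.
- by move=> z; case: (GF z).
move=> u v Kuv; split; first exact: cFs.
move=> t t01; split.
  by apply: FG; [exact: geom_bary Kuv (bary_seg u v t01)|exact: seg_p0].
move=> i; rewrite -ler_norml; apply: le_trans ((bP (u, v)).2 Kuv t t01 i) _.
by rewrite (bigD1 (u, v)) //= addrCA lerDl addr_ge0 // sumr_ge0.
Qed.

(** [T u v] carries data from v to u. The composition law includes degenerate triples: u = w makes
    the two transports along an edge inverse to each other. *)
Lemma monodromy (X : Type) (ok : V -> X -> Prop) (T : V -> V -> X -> X) :
  (forall v, exists x, ok v x) ->
  (forall v x, ok v x -> T v v x = x) ->
  (forall u v x, [set u; v]%SET \in simplices K -> ok v x -> ok u (T u v x)) ->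
  (forall u v w x, [set u; v; w]%SET \in simplices K -> ok w x ->
     T u v (T v w x) = T u w x) ->
  exists s : V -> X, (forall v, ok v (s v)) /\
    forall u v, [set u; v]%SET \in simplices K -> s u = T u v (s v).
Proof.
move=> Tex Tid Tok Tcomp.
have [[u0 [v0 [uv0 Kuv0]]]|noedge] :=
    pselect (exists u v, u != v /\ [set u; v]%SET \in simplices K); last first.
  have [s sP] := choice Tex; exists s; split => // u v Kuv.
  have [->|uv] := eqVneq u v; first by rewrite Tid.
  by exfalso; apply: noedge; exists u, v.
have [F [G [B [B0 cG KG segP]]]] := seg_chart uv0 Kuv0.
(* Coordinates sum to 1, so one of them is at least 1 / |V|. Since [G] varies by less than that
   between near grid points, the label of each lies in the support of the other. *)
pose n : R := (#|V|%:R)^-1.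
have V0 : (0 < #|V|)%N by apply/card_gt0P; exists u0.
have n0 : 0 < n by rewrite invr_gt0 ltr0n.
have BB : - B <= B by lra.
have cGB : map_cont_on (box (- B) B) G by apply: map_cont_onW cG.
have [d [d0 dP]] := box_uniform_cont cGB n0.
have [N [N0 Nd]] := fine_mesh BB d0; rewrite opprK in Nd.
pose pt := grid_pt (- B) B N.
have ptbox c : box (- B) B (pt c) by exact: grid_pt_box.
have dominant z : exists v, n <= G z v.
  apply: contrapT => /forallNP h; case: (KG z) => g0 g1 _.
  have : \sum_v G z v < \sum_(v : V) n.
    apply: ltr_sum; first by apply/hasP; exists u0; rewrite // mem_index_enum.
    by move=> v _; rewrite ltNge; exact/negP.
  by rewrite g1 sumr_const /n -[X in _ < X]mulr_natr mulVf ?ltxx // pnatr_eq0 -lt0n.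
have [dom domP] := choice dominant.
pose lab c := dom (pt c).
have labP c z : (forall i, `|G z i - G (pt c) i| < n) -> lab c \in supp (G z).
  move=> h; apply: supp_gt0; have := h (lab c); have := domP (pt c).
  by rewrite -/(lab c) ltr_norml => ? /andP[? _]; lra.
have ptnear c c' : near_cells c c' -> forall i, `|G (pt c) i - G (pt c') i| < n.
  move=> nc; apply: dP => // i; apply: le_lt_trans Nd.
  by have := grid_pt_near BB N0 nc i; rewrite opprK.
have labc c c' : near_cells c' c -> lab c \in supp (G (pt c')).
  by move=> nc; apply: labP; exact: ptnear.
have ncc c : near_cells c c by case: c => i j; split => /=.
have ncs c c' : near_cells c c' -> near_cells c' c by move=> [? ? ? ?]; split.
have [x0 ok0] := Tex (lab (0, 0)%N).
have [||||k [kok kP]] := @grid_section V X lab ok T x0.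
- exact: Tid.
- move=> c c' x nc okx; apply: Tok okx.
  by apply: (geom_simplex2 (KG (pt c))); apply: labc.
- move=> c1 c2 c3 x n12 n23 n13 okx; apply: Tcomp okx.
  by apply: (geom_simplex3 (KG (pt c3))); apply: labc => //; exact: ncs.
- exact: ok0.
pose ce u v t := cell B N (F (seg u v t)).
have labce u v t : [set u; v]%SET \in simplices K -> 0 <= t <= 1 ->
    lab (ce u v t) \in supp (seg u v t).
  move=> Kuv t01; have [_ /(_ t t01)[GFs bF]] := segP u v Kuv.
  rewrite -GFs; apply: labP; apply: dP => // i.
  exact: le_lt_trans (cell_pt_near B0 N0 bF i) Nd.
have sub2 u v t : 0 <= t <= 1 -> forall c, c \in supp (seg u v t) -> c = u \/ c = v.
  move=> t01 c; have [_ _ h] := bary_seg u v t01; rewrite inE => hc.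
  have [/set2P //|/h e] := boolP (c \in [set u; v]%SET).
  by rewrite e eqxx in hc.
have z01 : 0 <= (0 : R) <= 1 by rewrite lexx ler01.
have o01 : 0 <= (1 : R) <= 1 by rewrite lexx ler01.
have seg0 u v : seg u v 0 = delta R u by apply/funext => c; rewrite /seg; ring.
have seg1 u v : seg u v 1 = delta R v by apply/funext => c; rewrite /seg; ring.
have K1 u : [set u; u]%SET \in simplices K by rewrite finset.setUid; exact: simplex1.
(* The degenerate edge uu gives the cell of the vertex u, whose label can only be u. *)
pose s u := k (ce u u 0).
have labs u : lab (ce u u 0) = u by have /sub2[] := labce u u 0 (K1 u) z01.
exists s; split=> [v|u v Kuv]; first by have := kok (ce v v 0); rewrite labs.
have [cFs Fs] := segP u v Kuv.
have m0 : 0 < (B + B) / N%:R by rewrite divr_gt0 ?ltr0n // addr_gt0.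
have [e [e0 eP]] := box_uniform_cont cFs m0.
have [M [M0 Me]] := @fine_mesh R 0 1 e ler01 e0; rewrite subr0 in Me.
have M0' : 0 < M%:R :> R by rewrite ltr0n.
pose t (i : nat) : R := i%:R / M%:R.
have t01 i : (i <= M)%N -> 0 <= t i <= 1.
  by move=> iM; rewrite divr_ge0 //= ler_pdivrMr // mul1r ler_nat.
pose c i := ce u v (t i).
have cn i : (i < M)%N -> near_cells (c i) (c i.+1).
  move=> iM; have iM' := ltnW iM.
  have [_ b1] := Fs _ (t01 _ iM'); have [_ b2] := Fs _ (t01 _ iM).
  apply: cell_near => //; apply: (eP (fun=> t i) (fun=> t i.+1)) => [b|b|_];
    [exact: t01|exact: t01|].
  have Mi : 0 <= 1 / M%:R :> R by rewrite divr_ge0.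
  by rewrite /t -[i.+1%:R]natr1 mulrDl opprD addrA subrr sub0r normrN (ger0_norm Mi).
(* Along the edge every label is u or v, so by flatness the transport to u of the section is
   constant. *)
have chain i : (i <= M)%N -> T u (lab (c i)) (k (c i)) = T u (lab (c 0%N)) (k (c 0%N)).
  elim: i => [//|i IHi] iM; rewrite -(IHi (ltnW iM)) (kP _ _ (cn i iM)) Tcomp //.
  have := labce u v (t i) Kuv (t01 _ (ltnW iM)); rewrite -/(c i).
  have := labce u v (t i.+1) Kuv (t01 _ iM); rewrite -/(c i.+1).
  move=> /(sub2 _ _ _ (t01 _ iM)) h1 /(sub2 _ _ _ (t01 _ (ltnW iM))) h2.
  apply: (simplexW_mem Kuv (v := u)); last by rewrite !inE eqxx.
  by apply/fintype.subsetP => a; rewrite !inE; case: h1 => ->; case: h2 => ->;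
    do ?[case: eqP => //= _].
have t0E : t 0%N = 0 by rewrite /t mul0r.
have tME : t M = 1 by rewrite /t divff // lt0r_neq0.
have c0 : c 0%N = ce u u 0 by rewrite /c /ce t0E !seg0.
have cM : c M = ce v v 0 by rewrite /c /ce tME seg1 seg0.
have := chain M (leqnn M); rewrite c0 cM !labs => ->.
by rewrite Tid //; have := kok (ce u u 0); rewrite labs.
Qed.

End monodromy.

(** * The Farey graph and its reduction modulo 3 *)

Lemma sqr_eq1 (s : int) : s ^+ 2 = 1 -> s = 1 \/ s = -1.
Proof. by move/eqP; rewrite sqrf_eq1 => /orP[] /eqP; [left|right]. Qed.

Definition vec := (int * int)%type.

Definition vdet (a b : vec) : int := a.1 * b.2 - a.2 * b.1.

(* The point of the projective line over F_3 given by a vector, that is, its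
   slope modulo 3. *)
Definition slope (a : vec) : nat :=
  if (3 %| a.2)%Z then 0 else if (3 %| a.1)%Z then 1
  else if (3 %| a.1 - a.2)%Z then 2 else 3.

Definition vcomb (q : vec) (h : int) (a : vec) : vec :=
  (q.1 + h * a.1, q.2 + h * a.2).

Lemma slope_lt4 a : (slope a < 4)%N.
Proof. by rewrite /slope; do 3?case: ifP => //. Qed.

Lemma slope_mod3 (a b : vec) : (3 %| a.1 - b.1)%Z -> (3 %| a.2 - b.2)%Z ->
  slope a = slope b.
Proof.
move=> h1 h2; rewrite /slope.
have -> : (3 %| a.2)%Z = (3 %| b.2)%Z by lia.
have -> : (3 %| a.1)%Z = (3 %| b.1)%Z by lia.
by have -> : (3 %| a.1 - a.2)%Z = (3 %| b.1 - b.2)%Z by lia.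
Qed.

Lemma slope_scale (s : int) (a : vec) : s ^+ 2 = 1 ->
  slope (s * a.1, s * a.2) = slope a.
Proof.
move=> s2; have [->|->] : s = 1 \/ s = -1.
  exact: sqr_eq1.
  by rewrite !mul1r -surjective_pairing.
rewrite !mulN1r /slope /=.
have -> : (3 %| - a.2)%Z = (3 %| a.2)%Z by lia.
have -> : (3 %| - a.1)%Z = (3 %| a.1)%Z by lia.
by have -> : (3 %| - a.1 - - a.2)%Z = (3 %| a.1 - a.2)%Z by lia.
Qed.

Lemma slope_eq_det (a b : vec) : slope a = slope b -> (3 %| vdet a b)%Z.
Proof.
have dv (x y : int) : (3 %| x)%Z -> (3 %| y)%Z -> (3 %| a.1 * x - b.1 * y)%Z.
  by move=> hx hy; rewrite rpredB // dvdz_mull.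
have dv' (x y : int) : (3 %| x)%Z -> (3 %| y)%Z -> (3 %| a.2 * x - b.2 * y)%Z.
  by move=> hx hy; rewrite rpredB // dvdz_mull.
rewrite /slope /vdet.
case: ifP => a2; case: ifP => b2; do 4?case: ifP => //; move=> *.
all: try (rewrite (_ : a.1 * b.2 - a.2 * b.1 = a.1 * b.2 - b.1 * a.2);
  [exact: dv|ring]).
all: try (rewrite (_ : a.1 * b.2 - a.2 * b.1 = - (a.2 * b.1 - b.2 * a.1));
  [rewrite rpredN; exact: dv'|ring]).
all: try (rewrite (_ : a.1 * b.2 - a.2 * b.1 = a.1 * (b.2 - b.1) - b.1 * (a.2 - a.1));
  [apply: dv; lia|ring]).
all: rewrite (_ : a.1 * b.2 - a.2 * b.1 = a.1 * (b.2 + b.1) - b.1 * (a.2 + a.1));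
  [apply: dv; lia|ring].
Qed.

Lemma slope_neq (a b : vec) : vdet a b ^+ 2 = 1 -> slope a <> slope b.
Proof.
move=> d1 /slope_eq_det /dvdzP[k e]; move: d1; rewrite e => d1.
have : (3 %| (k * 3) ^+ 2)%Z by rewrite expr2 mulrA dvdz_mull.
by rewrite d1.
Qed.

(** Invertible matrices over F_3 act on the four points as the full symmetric group, and they lift
    to integer matrices of determinant 1 or -1. The list is a stock of small vectors that covers all
    24 triples. *)
Lemma frame_exists (c0 c1 c2 : nat) : (c0 < 4)%N -> (c1 < 4)%N -> (c2 < 4)%N ->
  c0 != c1 -> c0 != c2 -> c1 != c2 ->
  exists a b : vec, [/\ vdet a b ^+ 2 = 1, slope a = c0, slope b = c1
    & slope (vcomb b 1 a) = c2].
Proof.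
pose L : seq vec := [:: (1, 0); (0, 1); (1, 1); (1, -1); (1, 2); (2, 1); (-1, 0); (0, -1);
  (-1, -1); (-1, 1); (1, 3); (3, 1); (-1, 3); (3, -1); (-1,2); (-2, 1)].
move=> l0 l1 l2 n01 n02 n12.
suff /hasP[a _ /hasP[b _ /and4P[/eqP ? /eqP ? /eqP ? /eqP ?]]] :
  has (fun a => has (fun b => [&& vdet a b ^+ 2 == 1, slope a == c0, slope b == c1
    & slope (vcomb b 1 a) == c2]) L) L by exists a, b.
move: c0 c1 c2 l0 l1 l2 n01 n02 n12.
by do 3![case=> [|[|[|[|//]]]]].
Qed.

(** * Symmetric squares of Farey neighbours *)

Definition quad := (bool * bool -> int).

Definition proj (a : vec) (i : bool) : int := if i then a.1 else a.2.

Definition sq (a : vec) : quad := fun i => proj a i.1 * proj a i.2.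

Lemma vdet_sq (a b : vec) : vdet a b ^+ 2 =
  sq a (true, true) * sq b (false, false) + sq a (false, false) * sq b (true, true)
  - 2 * (sq a (true, false) * sq b (true, false)).
Proof. by rewrite /vdet /sq /=; ring. Qed.

(* The Farey neighbours of a are the vectors q + h a, for h in Z. Symmetric squares
   remove the sign ambiguity and turn this sequence into Q + h D + h^2 A; the triple
   (A, D, Q) thus encodes a lift of the star of a vertex. *)
Definition para := (quad * quad * quad)%type.

Definition value (x : para) (h : int) : quad :=
  fun i => x.2 i + h * x.1.2 i + h ^+ 2 * x.1.1 i.

Definition para_of (a q : vec) : para :=
  (sq a, fun i => proj a i.1 * proj q i.2 + proj q i.1 * proj a i.2, sq q).

Lemma value_para_of a q h : value (para_of a q) h = sq (vcomb q h a).
Proof.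
by apply/funext => -[i j]; rewrite /value /para_of /sq /=; case: i; case: j => /=; ring.
Qed.

(** [D] solves c - b = (j - i) D + (j^2 - i^2) A; as j - i will be 1 or -1, dividing by it is
    multiplying by it. *)
Definition interpolate (A b c : quad) (i j : int) : para :=
  let D := fun t => (j - i) * (c t - b t) - (j + i) * A t in
  (A, D, fun t => b t - i * D t - i ^+ 2 * A t).

Lemma interpolateP A b c i j : (j - i) ^+ 2 = 1 ->
  value (interpolate A b c i j) i = b /\ value (interpolate A b c i j) j = c.
Proof.
move=> ij; split; apply/funext => t; rewrite /value /=; first ring.
suff -> : forall x y z, y - i * ((j - i) * (x - y) - (j + i) * z) - i ^+ 2 * z +
   j * ((j - i) * (x - y) - (j + i) * z) + j ^+ 2 * z = y + (j - i) ^+ 2 * (x - y).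
  by rewrite ij; ring.
by move=> *; ring.
Qed.

Lemma para_unique x y i j : (j - i) ^+ 2 = 1 -> x.1.1 = y.1.1 ->
  value x i = value y i -> value x j = value y j -> x = y.
Proof.
move: x y => [[A D] Q] [[A' D'] Q'] ij /= <- ei ej.
have eD : D = D'.
  apply/funext => t; have := congr1 (@^~ t) ei; have := congr1 (@^~ t) ej.
  rewrite /value /= => h1 h2.
  have : (j - i) ^+ 2 * (D t - D' t) = 0.
    rewrite (_ : _ * _ = (j - i) * ((Q t + j * D t + j ^+ 2 * A t) -
      (Q t + i * D t + i ^+ 2 * A t) - (Q' t + j * D' t + j ^+ 2 * A t) +
      (Q' t + i * D' t + i ^+ 2 * A t))); last ring.
    by rewrite h1 h2; ring.
  by rewrite ij mul1r => /eqP; rewrite subr_eq0 => /eqP.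
rewrite -eD; congr (_, _, _); apply/funext => t.
by have := congr1 (@^~ t) ei; rewrite /value /= -eD => /addIr/addIr.
Qed.

(** The parallelogram law: across a Farey edge, the squares of the two opposite vertices add up to
    twice those of the ends. It is symmetric in the ends, so both stars compute the same opposite
    vertex. *)
Lemma value_reflect (x : para) (k s : int) : s ^+ 2 = 1 ->
  forall t, value x (k - s) t = 2 * value x k t + 2 * x.1.1 t - value x (k + s) t.
Proof.
move=> s1 t; rewrite /value; apply/eqP; rewrite -subr_eq0; apply/eqP.
have -> : 2 * x.1.1 t = 2 * (s ^+ 2 * x.1.1 t) by rewrite s1; ring.
ring.
Qed.

Lemma slope_vcomb (a q : vec) (h h' : int) : (3 %| h - h')%Z ->
  slope (vcomb q h a) = slope (vcomb q h' a).
Proof.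
move=> d; apply: slope_mod3; rewrite /vcomb /=.
  rewrite (_ : _ - _ = (h - h') * a.1); last ring.
  by rewrite dvdz_mulr.
rewrite (_ : _ - _ = (h - h') * a.2); last ring.
by rewrite dvdz_mulr.
Qed.

Lemma vdet_vcomb (a q : vec) (h : int) : vdet a (vcomb q h a) = vdet a q.
Proof. by rewrite /vdet /=; ring. Qed.

Lemma vdet_vcomb2 (a q : vec) (h h' : int) :
  vdet (vcomb q h a) (vcomb q h' a) = (h - h') * vdet a q.
Proof. by rewrite /vdet /=; ring. Qed.

(** * Lifting a colouring to the Farey complex *)

Section lift.
Variables (R : realType) (V : finType) (K : simplicial_complex V).
Hypothesis hK : sphere_triangulation R K.
Variables (alpha : V -> nat) (h : V -> V -> int).
Let nbr u v := (u != v) && ([set u; v]%SET \in simplices K).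
Let face u v w := [&& u != v, u != w, v != w & [set u; v; w]%SET \in simplices K].
Hypothesis alpha4 : forall v, (alpha v < 4)%N.
Hypothesis alphaP : forall u v, nbr u v -> alpha u != alpha v.
Hypothesis h_step : forall v u w, face v u w -> (h v u - h v w) ^+ 2 = 1.
Hypothesis h_color : forall v u w, nbr v u -> nbr v w ->
  (3 %| h v u - h v w)%Z = (alpha u == alpha w).

Let nbrC u v : nbr u v = nbr v u.
Proof. by rewrite /nbr eq_sym finset.setUC. Qed.

Let faceC u v w : face u v w = face v u w.
Proof.
rewrite /face [in RHS]eq_sym (finset.setUC [set u]%SET [set v]%SET).
by do ![case: (_ != _)].
Qed.

Let faceC' u v w : face u v w = face u w v.
Proof.
rewrite /face (eq_sym v w) -!finset.setUA (finset.setUC [set w]%SET [set v]%SET).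
by do ![case: (_ != _)].
Qed.

Let face_nbr u v w : face u v w -> nbr u v.
Proof.
case/and4P => uv uw vw Kuvw; rewrite /nbr uv; apply: (simplexW_mem Kuvw (v := u)).
  by apply/fintype.subsetP => a; rewrite !inE => ->.
by rewrite !inE eqxx.
Qed.

Let face_nbr' u v w : face u v w -> nbr u w.
Proof. by rewrite faceC'; exact: face_nbr. Qed.

Let nbr_face u v : nbr u v -> exists w, face u v w.
Proof.
case/andP => uv Kuv; have [w [wu wv Kuvw]] := edge_in_face hK uv Kuv.
by exists w; rewrite /face uv (eq_sym u) (eq_sym v) wu wv.
Qed.

(** If t has neither the colour of u nor that of w, its index lies in the third class modulo 3; then
    its colour and its slope are both the only one left by v, u, w. *)
Let colors_fill v a q u w : vdet a q ^+ 2 = 1 -> slope a = alpha v -> face v u w ->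
  slope (vcomb q (h v u) a) = alpha u -> slope (vcomb q (h v w) a) = alpha w ->
  forall t, nbr v t -> slope (vcomb q (h v t) a) = alpha t.
Proof.
move=> d1 av f au aw t vt.
have vu := face_nbr f; have vw := face_nbr' f.
have uw : nbr u w by move: f; rewrite faceC; exact: face_nbr'.
have [tu|tu] := eqVneq (alpha t) (alpha u).
  by rewrite tu -au; apply: slope_vcomb; rewrite h_color // tu.
have [tw|tw] := eqVneq (alpha t) (alpha w).
  by rewrite tw -aw; apply: slope_vcomb; rewrite h_color // tw.
have hs := sqr_eq1 (h_step f).
have n3 x y : nbr v x -> nbr v y -> alpha x != alpha y -> ~~ (3 %| h v x - h v y)%Z.
  by move=> vx vy xy; rewrite h_color.
have ntu := n3 _ _ vt vu tu; have ntw := n3 _ _ vt vw tw.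
set z := vcomb q (h v t) a.
have sz : slope z <> alpha v.
  by rewrite -av => /esym; apply: slope_neq; rewrite vdet_vcomb.
have det3 x : ~~ (3 %| h v t - h v x)%Z -> slope z <> slope (vcomb q (h v x) a).
  move=> nx /slope_eq_det; rewrite vdet_vcomb2.
  by have [->|->] := sqr_eq1 d1; rewrite ?mulr1 ?mulrN1 ?rpredN; exact/negP.
move: (det3 _ ntu) (det3 _ ntw) (slope_lt4 z) (alpha4 t) (alpha4 u) (alpha4 v) (alpha4 w)
  (alphaP uw) (alphaP vu) (alphaP vw) (alphaP vt) tu tw sz.
rewrite au aw; clear; lia.
Qed.

(** [h v t] is the index of t in the sequence of Farey neighbours q + h a. *)
Definition frame (v : V) (x : para) : Prop := exists a q : vec,
  [/\ x = para_of a q, vdet a q ^+ 2 = 1, slope a = alpha v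
    & forall t, nbr v t -> slope (vcomb q (h v t) a) = alpha t].

Let wit u v : V := odflt u [pick w | face u v w].

Let witP u v : nbr u v -> face u v (wit u v).
Proof.
by move=> /nbr_face[w f]; rewrite /wit; case: pickP => //= /(_ w); rewrite f.
Qed.

(** The star of u is rebuilt from its centre, the old centre at the index of v, and the third vertex
    of one face on the edge; [transport_agree] shows that every face on the edge fits. *)
Definition transport u v (x : para) : para :=
  if u == v then x else
  interpolate (value x (h v u)) x.1.1 (value x (h v (wit u v)))
    (h u v) (h u (wit u v)).

Let transport_id v x : transport v v x = x.
Proof. by rewrite /transport eqxx. Qed.

Let agree u v (y x : para) : Prop :=
  [/\ y.1.1 = value x (h v u), value y (h u v) = x.1.1
    & forall w, face u v w -> value y (h u w) = value x (h v w)].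

Let transport_agree u v x : nbr u v -> agree u v (transport u v x) x.
Proof.
move=> uv; have fuv := witP uv; set w := wit u v in fuv.
have ij : (h u w - h u v) ^+ 2 = 1 by apply: h_step; rewrite faceC'.
rewrite /transport (negPf (proj1 (andP uv))) -/w.
have [e1 e2] := interpolateP (value x (h v u)) x.1.1 (value x (h v w)) ij.
split => // t fuvt.
have fvut : face v u t by rewrite faceC.
have fvuw : face v u w by rewrite faceC.
have vu : nbr v u by rewrite nbrC.
have c1 := h_color (face_nbr' fuvt) (face_nbr' fuv).
have c2 := h_color (face_nbr' fvut) (face_nbr' fvuw).
have s1 := sqr_eq1 (h_step fuvt); have s2 := sqr_eq1 (h_step fuv).
have s3 := sqr_eq1 (h_step fvut); have s4 := sqr_eq1 (h_step fvuw).
(* In each link, t and w are one step from the other end of the edge. Equality of colours decides,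
   alike in both links, whether their indices coincide or mirror each other; the mirror case is the
   parallelogram law. *)
have [tw|tw] := eqVneq (alpha t) (alpha w).
  rewrite tw eqxx in c1 c2.
  have -> : h u t = h u w by move: c1 s1 s2; clear; lia.
  by have -> : h v t = h v w by move: c2 s3 s4; clear; lia.
rewrite (negPf tw) in c1 c2.
pose s := h u w - h u v; pose s' := h v w - h v u.
have ht : h u t = h u v - s by move: c1 s1 s2; rewrite /s; clear; lia.
have ht' : h v t = h v u - s' by move: c2 s3 s4; rewrite /s'; clear; lia.
have hw : h u w = h u v + s by rewrite /s; ring.
have hw' : h v w = h v u + s' by rewrite /s'; ring.
have s'1 : s' ^+ 2 = 1 by apply: h_step; rewrite faceC'.
apply/funext => i; rewrite ht ht' !value_reflect // -hw -hw' e1 e2 /=.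
by ring.
Qed.

Let frame_exists_at v : exists x, frame v x.
Proof.
have [[u vu]|isol] := pselect (exists u, nbr v u); last first.
  have [c1 [c2 [l1 l2 n1 n2 n3]]] : exists c1 c2, [/\ (c1 < 4)%N, (c2 < 4)%N,
      alpha v != c1, alpha v != c2 & c1 != c2].
    by have := alpha4 v; case: (alpha v) => [|[|[|[|//]]]] _;
      [exists 1%N, 2%N|exists 0%N, 2%N|exists 0%N, 1%N|exists 0%N, 1%N].
  have [a [q [d sa _ _]]] := frame_exists (alpha4 v) l1 l2 n1 n2 n3.
  by exists (para_of a q), a, q; split => // t vt; case: isol; exists t.
have [w f] := nbr_face vu.
have vw := face_nbr' f.
have uw : nbr u w by move: f; rewrite faceC; exact: face_nbr'.
have [a0 [b [d sa sb sc]]] := frame_exists (alpha4 v) (alpha4 u) (alpha4 w)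
  (alphaP vu) (alphaP vw) (alphaP uw).
pose s := h v w - h v u.
have s1 : s ^+ 2 = 1 by apply: h_step; rewrite faceC'.
(* The sign [s] makes the step from u to w, upward or downward, add exactly [a0]; the shift by
   [- h v u] then puts [b] at the index of u. *)
pose a : vec := (s * a0.1, s * a0.2).
pose q := vcomb b (- h v u) a.
have qu : vcomb q (h v u) a = b.
  by rewrite /q /vcomb /= [RHS]surjective_pairing; congr (_, _); ring.
have qw : vcomb q (h v w) a = vcomb b 1 a0.
  rewrite /q /vcomb /=; congr (_, _).
    rewrite (_ : _ + _ = b.1 + s ^+ 2 * a0.1); last by rewrite /s; ring.
    by rewrite s1.
  rewrite (_ : _ + _ = b.2 + s ^+ 2 * a0.2); last by rewrite /s; ring.
  by rewrite s1.
have da : vdet a q ^+ 2 = 1.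
  by rewrite vdet_vcomb /vdet /= -[RHS]mulr1 -{1}s1 -d /vdet; ring.
have sa' : slope a = alpha v by rewrite slope_scale.
exists (para_of a q), a, q; split => //.
by apply: (colors_fill da sa' f); rewrite ?qu ?qw.
Qed.

Let transport_frame u v x : [set u; v]%SET \in simplices K -> frame v x ->
  frame u (transport u v x).
Proof.
move=> Kuv fx; have [e|uvn] := eqVneq u v; first by rewrite /transport e eqxx.
have uv : nbr u v by rewrite /nbr uvn.
have [A1 A2 A3] := transport_agree x uv.
have fuv := witP uv; set w := wit u v in fuv; have {}A3 := A3 w fuv.
have fvuw : face v u w by rewrite faceC.
have vu : nbr v u by rewrite nbrC.
have [a [q [ex d sa sn]]] := fx.
pose a' := vcomb q (h v u) a.
pose s := h v w - h v u; pose s' := h u w - h u v.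
have s1 : s ^+ 2 = 1 by apply: h_step; rewrite faceC'.
have s'1 : s' ^+ 2 = 1 by apply: h_step; rewrite faceC'.
have ss1 : (s * s') ^+ 2 = 1 by rewrite exprMn s1 s'1 mulr1.
(* This sign puts v and w at their indices in the link of u, each up to a sign that squares and
   slopes do not see. *)
pose sa0 : vec := (s * s' * a.1, s * s' * a.2).
pose q' := vcomb sa0 (- h u v) a'.
have qv : vcomb q' (h u v) a' = sa0.
  by rewrite /q' /vcomb /=; congr (_, _); ring.
pose cw := vcomb q (h v w) a.
have qw : vcomb q' (h u w) a' = (s' * cw.1, s' * cw.2).
  have e1 i : proj (vcomb q' (h u w) a') i = s' * proj cw i.
    have -> : proj cw i = proj a' i + s * proj a i.
      by case: i; rewrite /cw /a' /s /vcomb /=; ring.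
    by rewrite (_ : proj (vcomb _ _ _) i = s * s' * proj a i + s' * proj a' i);
      [ring|case: i; rewrite /q' /sa0 /s' /vcomb /=; ring].
  by rewrite [LHS]surjective_pairing; congr (_, _); [exact: (e1 true)|exact: (e1 false)].
have sq_scale t (z : vec) : t ^+ 2 = 1 -> sq (t * z.1, t * z.2) = sq z.
  move=> t1; apply/funext => -[i j]; rewrite /sq -[RHS]mul1r -t1.
  by case: i; case: j => /=; ring.
have et : transport u v x = para_of a' q'.
  apply: (@para_unique _ _ (h u v) (h u w) s'1) => //.
  - by rewrite A1 ex value_para_of.
  - by rewrite A2 ex value_para_of qv sq_scale.
  - by rewrite A3 ex !value_para_of qw sq_scale.
exists a', q'; split => //.
- rewrite vdet_vcomb -d -[RHS]mul1r -{1}ss1 /vdet /a' /sa0 /=; ring.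
- exact: sn.
have sa' : slope a' = alpha u by exact: sn.
apply: (colors_fill _ sa' fuv).
- rewrite vdet_vcomb -d -[RHS]mul1r -{1}ss1 /vdet /a' /sa0 /=; ring.
- by rewrite qv slope_scale.
- by rewrite qw slope_scale //; apply: sn; exact: face_nbr' fvuw.
Qed.

Let transport_comp u v w x : [set u; v; w]%SET \in simplices K ->
  transport u v (transport v w x) = transport u w x.
Proof.
move=> Kuvw.
have [->|vw] := eqVneq v w; first by rewrite transport_id.
have [->|uv] := eqVneq u v; first by rewrite transport_id.
have sub (A : {set V}) c : A \subset [set u; v; w]%SET -> c \in A -> A \in simplices K.
  exact: simplexW_mem.
have nvw : nbr v w.
  rewrite /nbr vw; apply: (sub _ v); last by rewrite !inE eqxx.
  by apply/fintype.subsetP => c; rewrite !inE => /orP[] ->; rewrite ?orbT.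
have nuv : nbr u v.
  rewrite /nbr uv; apply: (sub _ u); last by rewrite !inE eqxx.
  by apply/fintype.subsetP => c; rewrite !inE => ->.
have [A1 A2 A3] := transport_agree x nvw.
set y := transport v w x in A1 A2 A3 *.
have [B1 B2 B3] := transport_agree y nuv.
set z := transport u v y in B1 B2 B3 *.
have [e|uw] := eqVneq u w.
  subst w; rewrite transport_id.
  have f := witP nuv; set t := wit u v in f.
  have f' : face v u t by rewrite faceC.
  apply: (@para_unique _ _ (h u v) (h u t)).
  - by apply: h_step; rewrite faceC'.
  - by rewrite B1 A2.
  - by rewrite B2 A1.
  - by rewrite B3 // A3.
have f : face u v w by rewrite /face uv uw vw.
have nuw := face_nbr' f.
have [C1 C2 C3] := transport_agree x nuw.
set z' := transport u w x in C1 C2 C3 *.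
have fvwu : face v w u by rewrite faceC' faceC.
have fuwv : face u w v by rewrite faceC'.
apply: (@para_unique _ _ (h u v) (h u w)).
- by apply: h_step; rewrite faceC'.
- by rewrite B1 C1 A3.
- by rewrite B2 A1 C3.
- by rewrite B3 // A2 C2.
Qed.

Lemma farey_lift : exists phi : V -> vec,
  [/\ forall v, slope (phi v) = alpha v,
      forall v, exists q, vdet (phi v) q ^+ 2 = 1
    & forall u v, u != v -> [set u; v]%SET \in simplices K ->
        vdet (phi u) (phi v) ^+ 2 = 1].
Proof.
have [s [sok sT]] := monodromy hK frame_exists_at
  (fun v x _ => transport_id v x) transport_frame
  (fun u v w x Kuvw _ => transport_comp x Kuvw).
(* Signs are chosen independently at the vertices; squared determinants ignore them. *)
have [phi phiP] := choice sok.
exists phi; split.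
- by move=> v; have [q []] := phiP v.
- by move=> v; have [q [_ d _ _]] := phiP v; exists q.
move=> u v uvn Kuv; have uv : nbr u v by rewrite /nbr uvn.
have [A1 _ _] := transport_agree (s v) uv; move: A1; rewrite -sT //.
have [q [eu _ _ _]] := phiP u; have [q' [ev d _ _]] := phiP v.
rewrite eu ev value_para_of /= => e.
have : vdet (phi v) (phi u) ^+ 2 = 1.
  by rewrite vdet_sq e -vdet_sq vdet_vcomb.
by rewrite /vdet => <-; ring.
Qed.

End lift.

(** * Descent on the Farey graph *)

Definition height (a : vec) : int := a.1 ^+ 2 - a.1 * a.2 + a.2 ^+ 2.

Definition polar (a b : vec) : int :=
  2 * (a.1 * b.1) - a.1 * b.2 - a.2 * b.1 + 2 * (a.2 * b.2).

Lemma height_ge0 a : 0 <= height a.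
Proof.
have : 4 * height a = (2 * a.1 - a.2) ^+ 2 + 3 * a.2 ^+ 2 by rewrite /height; ring.
have := sqr_ge0 (2 * a.1 - a.2); have := sqr_ge0 a.2; lia.
Qed.

Lemma height_gram a b :
  4 * (height a * height b) = polar a b ^+ 2 + 3 * vdet a b ^+ 2.
Proof. by rewrite /height /polar /vdet; ring. Qed.

(* The Farey neighbours of z form a sequence w + k z on which the height is a
   convex quadratic function of k; above height 1, only two consecutive terms,
   the parents of z, are not higher than z. *)
Lemma farey_flip (z q : vec) : vdet z q ^+ 2 = 1 -> 1 < height z ->
  exists w z', [/\ vdet z' w ^+ 2 = 1, height z' < height z, vdet z z' ^+ 2 = 4
    & forall u, vdet z u ^+ 2 = 1 -> height u <= height z -> vdet z' u ^+ 2 = 1].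
Proof.
move=> dq n1; pose n := height z; pose Q := (- polar z q %/ (2 * n))%Z.
pose r := (- polar z q %% (2 * n))%Z.
have nn : 0 < 2 * n by rewrite /n; lia.
have r0 : 0 <= r by rewrite /r modz_ge0 // gt_eqF.
have rn : r < 2 * n by rewrite /r ltz_pmod.
have Qr : - polar z q = Q * (2 * n) + r by exact: divz_eq.
(* [w] is the neighbour of z with polar value - r, 0 <= r < 2n. The parents are [w] and w + z, and
   [z'] is their other common neighbour. *)
pose w := vcomb q Q z; pose z' := vcomb z 2 w.
have dw : vdet z w = vdet z q by rewrite /w vdet_vcomb.
have pw : polar z w = - r.
  have -> : polar z w = polar z q + Q * (2 * n) by rewrite /polar /n /height /=; ring.
  lia.
have gw : 4 * (n * height w) = r ^+ 2 + 3.
  by rewrite height_gram pw dw dq; ring.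
have m0 := height_ge0 w.
have rpos : 0 < r.
  rewrite lt_def r0 andbT; apply/eqP => r_0; rewrite r_0 in gw; move: gw; lia.
(* The form omits the value 2. From n >= 3 follows r (2n - r) >= 2n - 1 > 3, which is what the
   decrease of height requires. *)
have n2 : 2 < n.
  rewrite lt_neqAle; have -> : 2 <= n by rewrite /n; lia.
  rewrite andbT; apply/eqP => n_2; rewrite -n_2 in gw rn.
  have r123 : r = 1 \/ r = 2 \/ r = 3 by lia.
  by move: gw; case: r123 => [|[|]] ->; lia.
exists w, z'; split.
- by rewrite -dq -dw /z' /vdet /=; ring.
- have -> : height z' = height z + (4 * height w - 2 * r).
    have -> : - (2 * r) = 2 * polar z w by rewrite pw; ring.
    by rewrite /z' /height /polar /=; ring.
  have : 4 * n * (2 * height w) < 4 * n * r.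
    rewrite (_ : 4 * n * (2 * height w) = 2 * (4 * (n * height w))); last ring.
    by rewrite gw; nia.
  rewrite ltr_pM2l; last lia.
  by lia.
- rewrite (_ : vdet z z' = 2 * vdet z w); last by rewrite /z' /vdet /=; ring.
  by rewrite exprMn dw dq.
move=> u du hu; pose J := vdet u w.
(* Up to sign u = w + j z; the height bound will leave only the two parents, j = 0 and j = 1. *)
pose j := vdet z u * J.
have zu : vdet z' u = vdet z u * (1 - 2 * j).
  rewrite (_ : vdet z u * (1 - 2 * j) = vdet z u - 2 * (vdet z u ^+ 2 * J)).
    by rewrite du /z' /J /vdet /=; ring.
  by rewrite /j; ring.
rewrite zu exprMn du mul1r.
have hj : height u = j ^+ 2 * n - j * r + height w.
  have -> : height u = vdet z w ^+ 2 * height u by rewrite dw dq mul1r.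
  have -> : vdet z w ^+ 2 * height u =
      J ^+ 2 * n + J * vdet z u * polar z w + vdet z u ^+ 2 * height w.
    by rewrite /J /n /height /polar /vdet; ring.
  rewrite pw du mul1r /j.
  rewrite (_ : (vdet z u * J) ^+ 2 = vdet z u ^+ 2 * J ^+ 2); last ring.
  by rewrite du; ring.
have gj : 4 * (n * height u) = (2 * n * j - r) ^+ 2 + 3.
  rewrite hj (_ : 4 * _ = 4 * n * (j ^+ 2 * n - j * r) + 4 * (n * height w)); last ring.
  by rewrite gw; ring.
have lt : (2 * n * j - r) ^+ 2 < (2 * n) ^+ 2.
  have : n * height u <= n * n by rewrite ler_pM2l // /n; lia.
  by rewrite !expr2 in gj *; lia.
have j01 : j = 0 \/ j = 1.
  have : -(2 * n) < 2 * n * j - r < 2 * n.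
    rewrite -ltr_norml -(ltr_pXn2r (_ : (0 < 2)%N)) ?nnegrE ?normr_ge0 ?ltW //.
    by rewrite real_normK ?num_real.
  move=> /andP[l1 l2]; clear -l1 l2 rn rpos nn; nia.
by case: j01 => ->.
Qed.

(** * Descent to a 3-colouring *)

Section pruning.
Variables (V : finType) (e : rel V).
Hypotheses (e_irr : forall u v, e u v -> u != v) (e_sym : symmetric e).

(** The first clause is primitivity; it supplies the neighbour from which [farey_flip] starts. *)
Definition farey_map (phi : V -> vec) : Prop :=
  (forall v, exists q, vdet (phi v) q ^+ 2 = 1) /\
  (forall u v, e u v -> vdet (phi u) (phi v) ^+ 2 = 1).

Definition slope_fun (phi : V -> vec) : {ffun V -> 'I_4} :=
  [ffun v => Ordinal (slope_lt4 (phi v))].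

Lemma slope_proper phi : farey_map phi -> proper_coloring e (slope_fun phi).
Proof.
move=> [_ d]; apply/forallP => u; apply/forallP => v; apply/implyP => /d duv.
by rewrite !ffunE -val_eqE /=; apply/eqP/slope_neq.
Qed.

Definition slope_coloring phi (fm : farey_map phi) : coloring e 4 :=
  exist _ (slope_fun phi) (slope_proper fm).

(** Both coordinates must be 0, 1 or -1, and among such vectors only (1, -1) and (-1, 1) have slope
    3; their height is 3. *)
Lemma low_slope (a : vec) : height a <= 1 -> slope a != 3.
Proof.
move=> ha; have e1 : 4 * height a = (2 * a.1 - a.2) ^+ 2 + 3 * a.2 ^+ 2.
  by rewrite /height; ring.
have e2 : 4 * height a = (2 * a.2 - a.1) ^+ 2 + 3 * a.1 ^+ 2.
  by rewrite /height; ring.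
have := sqr_ge0 (2 * a.1 - a.2); have := sqr_ge0 (2 * a.2 - a.1) => h1 h2.
have b1 : a.1 ^+ 2 <= 1 by lia.
have b2 : a.2 ^+ 2 <= 1 by lia.
have c1 : a.1 = 0 \/ a.1 = 1 \/ a.1 = -1 by move: b1; clear; nia.
have c2 : a.2 = 0 \/ a.2 = 1 \/ a.2 = -1 by move: b2; clear; nia.
move: ha; rewrite /slope /height.
by case: c1 => [->|[->|->]]; case: c2 => [->|[->|->]].
Qed.

(** Induction on the total height. A vertex of maximal height is flipped, so no neighbour is higher
    and all adjacencies survive. *)
Lemma farey_component phi (fm : farey_map phi) :
  slope_coloring fm \in three_coloring_component e.
Proof.
have [n] := ubnP (\sum_v `|height (phi v)|%N).
elim: n => // n IHn in phi fm *; rewrite ltnS => le_n.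
have [[v0 hv0]|low] := pselect (exists v, 1 < height (phi v)); last first.
  rewrite inE; apply/existsP; exists (slope_coloring fm); rewrite connect0 andbT.
  rewrite /three_coloring; apply: (@leq_trans #|[set~ (ord_max : 'I_4)]%SET|).
    apply/subset_leq_card/fintype.subsetP => c /imsetP[v _ ->].
    rewrite !inE ffunE -val_eqE /=; apply: low_slope.
    by rewrite leNgt; apply/negP => h; apply: low; exists v.
  by rewrite finset.cardsC1 card_ord.
pose v := [arg max_(u > v0) `|height (phi u)|%N].
have vmax u : height (phi u) <= height (phi v).
  rewrite /v; case: arg_maxnP => // t _ /(_ u isT).
  have := height_ge0 (phi u); have := height_ge0 (phi t); lia.
have hv : 1 < height (phi v) := lt_le_trans hv0 (vmax v0).
have [q dq] := fm.1 v.
have [w [z' [d1 hz' d4 dz']]] := farey_flip dq hv.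
pose phi' u := if u == v then z' else phi u.
have phi'v : phi' v = z' by rewrite /phi' eqxx.
have phi'n u : u != v -> phi' u = phi u by rewrite /phi' => /negPf ->.
have vdetC a b : vdet a b ^+ 2 = vdet b a ^+ 2 by rewrite /vdet; ring.
have dv u : e u v -> vdet (phi u) z' ^+ 2 = 1.
  by move=> uv; rewrite vdetC; apply: dz'; [rewrite vdetC; exact: fm.2|exact: vmax].
have fm' : farey_map phi'.
  split=> [u|a b ab].
    rewrite /phi'; case: eqP => [_|_]; [by exists w|exact: fm.1].
  have nab := e_irr ab; rewrite /phi'.
  have [av|_] := eqVneq a v; have [bv|_] := eqVneq b v.
  - by rewrite av bv eqxx in nab.
  - by rewrite vdetC; apply: dv; rewrite e_sym -av.
  - by apply: dv; rewrite -bv.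
  - exact: fm.2.
have : slope_coloring fm' \in three_coloring_component e.
  apply: IHn; apply: leq_trans le_n.
  rewrite (bigD1 v) //= [X in (_ < X)%N](bigD1 v) //= phi'v.
  rewrite (eq_bigr (fun u => `|height (phi u)|%N)); last by move=> u /phi'n ->.
  rewrite ltn_add2r; have := height_ge0 z'; lia.
rewrite !inE => /existsP[b /andP[tb cb]]; apply/existsP; exists b; rewrite tb.
apply: connect_trans cb _; apply: connect1; rewrite /single_change.
apply/cards1P; exists v; apply/finset.setP => u; rewrite !inE /= !ffunE -val_eqE /=.
have [->|uv] := eqVneq u v; last by rewrite phi'n // eqxx.
(* Old and new vectors have determinant 2 or -2, prime to 3, so the colour does change. *)
rewrite phi'v; apply/eqP => /slope_eq_det; rewrite /= => /dvdzP[t et].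
have : vdet (phi v) z' = - (t * 3) by rewrite -et /vdet; ring.
by move=> et'; move: d4; rewrite et' sqrrN => d4; clear -d4; nia.
Qed.

End pruning.

(** * Links and signatures *)

Section orientation_facts.
Variables (V : finType) (K : simplicial_complex V) (o : orientation K).

Lemma pos_face u v w : o u v w -> uniq [:: u; v; w] /\ [set u; v; w]%SET \in faces K.
Proof. by case: o => p h1 h2 h3 h4; exact: h1. Qed.

Lemma pos_rot u v w : o u v w = o v w u.
Proof. by case: o => p h1 h2 h3 h4; exact: h2. Qed.

Lemma pos_swap u v w : [set u; v; w]%SET \in faces K -> o u v w = ~~ o u w v.
Proof. by case: o => p h1 h2 h3 h4; exact: h3. Qed.

Lemma pos_coherent u v w w' : w != w' -> [set u; v; w]%SET \in faces K ->
  [set u; v; w']%SET \in faces K -> o u v w = o v u w'.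
Proof. by case: o => p h1 h2 h3 h4; exact: h4. Qed.

Lemma pos_asym u v w : o u v w -> o u w v = false.
Proof. by move=> p; have := pos_swap (pos_face p).2; rewrite p => /esym/negbTE. Qed.

Lemma pos_uniq u v w w' : o u v w -> o u v w' -> w = w'.
Proof.
move=> p p'; apply/eqP/negPn/negP => ww'.
have := pos_coherent ww' (pos_face p).2 (pos_face p').2.
by rewrite p pos_rot (pos_asym p').
Qed.

Lemma skeleton_sym : symmetric (skeleton K).
Proof. by move=> u v; rewrite /skeleton eq_sym finset.setUC. Qed.

Lemma skeleton_irr u v : skeleton K u v -> u != v.
Proof. by case/andP. Qed.

Lemma faceP u v w : u != v -> u != w -> v != w ->
  [set u; v; w]%SET \in simplices K -> [set u; v; w]%SET \in faces K.
Proof.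
move=> uv uw vw Kuvw; rewrite inE Kuvw /=.
by rewrite -finset.setUA cardsU1 cards2 !inE negb_or uv uw vw.
Qed.

Lemma pos_nbr u v w : o u v w -> [/\ skeleton K u v, skeleton K u w & skeleton K v w].
Proof.
move=> /pos_face[]; rewrite /= !inE negb_or andbT => /andP[/andP[uv uw] vw] /andP[Ks _].
split; rewrite /skeleton ?uv ?uw ?vw /=.
- apply: (simplexW_mem Ks (v := u)); last by rewrite !inE eqxx.
  by apply/fintype.subsetP => a; rewrite !inE => ->.
- apply: (simplexW_mem Ks (v := u)); last by rewrite !inE eqxx.
  by apply/fintype.subsetP => a; rewrite !inE => /orP[] ->; rewrite ?orbT.
- apply: (simplexW_mem Ks (v := v)); last by rewrite !inE eqxx.
  by apply/fintype.subsetP => a; rewrite !inE => /orP[] ->; rewrite ?orbT.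
Qed.

Lemma pos_or u v w : u != v -> u != w -> v != w ->
  [set u; v; w]%SET \in simplices K -> o u v w || o u w v.
Proof.
by move=> uv uw vw Ks; rewrite (pos_swap (faceP uv uw vw Ks)); case: (o u w v).
Qed.

(** The default u makes this the identity off the link of v, hence a permutation of V along which
    sums can be reindexed. *)
Definition link_next (v u : V) : V := odflt u [pick w | o v u w].

Lemma link_nextE v u w : o v u w -> link_next v u = w.
Proof.
move=> p; rewrite /link_next; case: pickP => [w' p'|/(_ w)]; last by rewrite p.
exact: pos_uniq p' p.
Qed.

Variables (R : realType).
Hypothesis hK : sphere_triangulation R K.

Lemma pos_next v u : skeleton K v u -> o v u (link_next v u).
Proof.
case/andP => vu Kvu.
have [w [w' [ww' [wv wu] [wv' wu'] Kw Kw']]] := edge_in_two_faces hK vu Kvu.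
have vw : v != w by rewrite eq_sym.
have vw' : v != w' by rewrite eq_sym.
have uw : u != w by rewrite eq_sym.
have uw' : u != w' by rewrite eq_sym.
have c := pos_coherent ww' (faceP vu vw uw Kw) (faceP vu vw' uw' Kw').
have /orP[p|p] := pos_or vu vw' uw' Kw'; first by rewrite (link_nextE p).
have p' : o v u w by rewrite c pos_rot.
by rewrite (link_nextE p').
Qed.

Lemma next_nbr v u : skeleton K v (link_next v u) = skeleton K v u.
Proof.
apply/idP/idP => [|/pos_next/pos_nbr[]//].
by rewrite {1}/link_next; case: pickP => // w /pos_nbr[].
Qed.

Lemma next_inj v : injective (link_next v).
Proof.
move=> u u' e; have n := next_nbr v u; have n' := next_nbr v u'.
have [vu|vu] := boolP (skeleton K v u).
  have vu' : skeleton K v u' by rewrite -n' -e n.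
  have := pos_next vu'; have := pos_next vu; rewrite e.
  by rewrite pos_rot pos_rot => p; rewrite pos_rot pos_rot; exact: pos_uniq p.
have vu' : ~~ skeleton K v u' by rewrite -n' -e n.
have fix_ t : ~~ skeleton K v t -> link_next v t = t.
  by rewrite /link_next; case: pickP => //= w /pos_nbr[->].
by rewrite -(fix_ u vu) -(fix_ u' vu').
Qed.

Lemma prev_exists v u : skeleton K v u -> exists t, o v t u.
Proof.
rewrite skeleton_sym => /pos_next p; exists (link_next u v).
by rewrite pos_rot pos_rot.
Qed.

(** [link_connected] is applied to an orbit: a face at v joins a vertex to its successor or
    predecessor, so none leads out of the orbit. *)
Lemma link_orbit v u w : skeleton K v u -> skeleton K v w ->
  fconnect (link_next v) u w.
Proof.
move=> vu vw; apply/negPn/negP => nc.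
case/andP: (vu) => uv Kvu; case/andP: (vw) => wv Kvw.
rewrite eq_sym in uv; rewrite eq_sym in wv.
have [a [b [av bv ua ub Kab]]] :=
  link_connected (A := fun t => fconnect (link_next v) u t) hK uv wv Kvu Kvw
    (connect0 _ _) (negP nc).
have ab : a != b by apply/eqP => e; rewrite -e ua in ub.
have va : v != a by rewrite eq_sym.
have vb : v != b by rewrite eq_sym.
apply: ub; apply: connect_trans ua _.
case/orP: (pos_or va vb ab Kab) => /link_nextE <-; first exact: fconnect1.
by rewrite fconnect_sym ?fconnect1 //; exact: next_inj.
Qed.

Definition sgn (a : V -> 'I_4) (v u : V) : int :=
  if positive_colors (a v) (a u) (a (link_next v u)) then 1 else -1.

Definition link_sum (a : V -> 'I_4) (v : V) : int :=
  \sum_(u | skeleton K v u) sgn a v u.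

Lemma positive_colors_rot (a b c : 'I_4) : positive_colors a b c = positive_colors b c a.
Proof.
move: a b c; do 3![case=> [[|[|[|[|//]]]] ?]]; by [].
Qed.

(** The positive orders of a face are rotations of one another, and [positive_colors] is invariant
    under rotation. *)
Lemma signatureE a v u w : o v u w ->
  signature o a [set v; u; w]%SET = if positive_colors (a v) (a u) (a w) then 1 else -1.
Proof.
move=> p; rewrite /signature; congr (if _ then _ else _).
apply/idP/idP => [|pc]; last first.
  by do 3 (apply/existsP; eexists); apply/and3P; split; [exact: p| |exact: pc].
have key y z : o v y z -> y \in [set v; u; w]%SET -> z \in [set v; u; w]%SET ->
    positive_colors (a v) (a y) (a z) -> positive_colors (a v) (a u) (a w).
  move=> q yf zf.
  have := (pos_face q).1; rewrite /= !inE negb_or andbT => /andP[/andP[vy vz] yz].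
  move: yf; rewrite !inE -orbA eq_sym (negPf vy) /= => /orP[]/eqP ey.
    by rewrite ey in q *; rewrite (pos_uniq q p).
  move: zf; rewrite !inE -orbA eq_sym (negPf vz) /= => /orP[]/eqP ez.
    by rewrite ey ez (pos_asym p) in q.
  by rewrite ey ez eqxx in yz.
move=> /existsP[x /existsP[y /existsP[z /and3P[q /eqP e pc]]]].
have xf : x \in [set v; u; w]%SET by rewrite e !inE eqxx.
have yf : y \in [set v; u; w]%SET by rewrite e !inE eqxx orbT.
have zf : z \in [set v; u; w]%SET by rewrite e !inE eqxx orbT.
have vf : v \in [set x; y; z]%SET by rewrite -e !inE eqxx.
move: vf; rewrite !inE => /orP[/orP[]|] /eqP ev.
- by rewrite -ev in q pc yf zf; exact: (key y z q yf zf pc).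
- rewrite -ev pos_rot in q; rewrite -ev positive_colors_rot in pc.
  exact: (key z x q zf xf pc).
- rewrite -ev -pos_rot in q; rewrite -ev -positive_colors_rot in pc.
  exact: (key x y q xf yf pc).
Qed.

Lemma link_face_inj v : {in [pred u | skeleton K v u] &,
  injective (fun u => [set v; u; link_next v u]%SET)}.
Proof.
move=> u u' vu vu' e; rewrite !inE in vu vu'.
have p := pos_next vu; have p' := pos_next vu'.
have : u \in [set v; u'; link_next v u']%SET by rewrite -e !inE eqxx orbT.
have : u' \in [set v; u; link_next v u]%SET by rewrite e !inE eqxx orbT.
rewrite !inE -!orbA ![_ == v]eq_sym (negPf (skeleton_irr vu)) (negPf (skeleton_irr vu')) /=.
case/orP => /eqP // e1; case/orP => /eqP // e2.
by move: p' p; rewrite -e1 -e2 => p'; rewrite (pos_asym p').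
Qed.

(** Each face at v is counted once, under the vertex that follows v in its positive order. *)
Lemma card_faces_at a v (s : int) :
  #|faces_at o a v s| = #|[set u | skeleton K v u && (sgn a v u == s)]%SET|.
Proof.
rewrite -(card_in_imset (f := fun u => [set v; u; link_next v u]%SET)); last first.
  by move=> u u'; rewrite !inE => /andP[vu _] /andP[vu' _]; apply: link_face_inj; rewrite inE.
congr #|pred_of_set _|; apply/finset.setP => f; apply/idP/imsetP; last first.
  move=> [u]; rewrite inE => /andP[vu /eqP su] ->; have p := pos_next vu.
  by rewrite /faces_at inE (pos_face p).2 (signatureE a p) -/(sgn a v u) su !inE !eqxx.
rewrite /faces_at inE => /andP[fK /andP[vf /eqP fs]].
have [x [y [px fe]]] : exists x y, o v x y /\ f = [set v; x; y]%SET.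
  have /andP[fKs /eqP f3] : (f \in simplices K) && (#|f| == 3%N) by rewrite inE in fK.
  have : #|f :\ v| = 2%N by have := cardsD1 v f; rewrite vf f3 add1n => -[->].
  move/eqP/cards2P => [x [y [xy fxy]]].
  have fe : f = [set v; x; y]%SET by rewrite -(finset.setD1K vf) fxy finset.setUA.
  have vx : v != x.
    by apply/eqP => e; have := finset.setD11 v f; rewrite fxy e !inE eqxx.
  have vy : v != y.
    by apply/eqP => e; have := finset.setD11 v f; rewrite fxy e !inE eqxx orbT.
  rewrite fe in fKs; case/orP: (pos_or vx vy xy fKs) => p; first by exists x, y.
  by exists y, x; split => //; rewrite fe -!finset.setUA (finset.setUC [set x]%SET).
have [vx _ _] := pos_nbr px.
exists x; last by rewrite fe (link_nextE px).
by rewrite inE vx /= /sgn (link_nextE px) -fs fe (signatureE a px).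
Qed.

Lemma balancedE a : balanced o a <-> forall v, link_sum a v = 0.
Proof.
have E v : link_sum a v = #|faces_at o a v 1|%:Z - #|faces_at o a v (-1)|%:Z.
  rewrite !card_faces_at -!sum1_card /link_sum.
  rewrite (bigID (fun u => sgn a v u == 1)) /=.
  rewrite (eq_bigr (fun=> 1)) => [|u /andP[_ /eqP //]].
  rewrite [X in _ + X](eq_bigr (fun=> - 1)) => [|u /andP[_]]; last first.
    by rewrite /sgn; case: ifP.
  rewrite sumrN -!(big_morph Posz PoszD (erefl _)); congr (Posz _ - Posz _).
    by apply: eq_bigl => u; rewrite inE.
  by apply: eq_bigl => u; rewrite inE /sgn; case: ifP.
split=> [b v|b v]; first by rewrite E b subrr.
by have /eqP := b v; rewrite E subr_eq0 => /eqP[].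
Qed.
End orientation_facts.

(* Over each colour c, the three other colours in the cyclic order for which
   positive_colors c x y means that y follows x. *)
Definition color_index (c x : nat) : nat :=
  nth 0%N (nth [::] [:: [:: 0; 0; 2; 1]; [:: 2; 0; 0; 1]; [:: 1; 0; 0; 2];
    [:: 0; 1; 2; 0]]%N c) x.

Lemma color_index_step (c x y : 'I_4) : c != x -> c != y -> x != y ->
  (3 %| (color_index c y)%:Z - (color_index c x)%:Z
        - (if positive_colors c x y then 1 else - 1))%Z.
Proof. by move: c x y; do 3![case=> [[|[|[|[|//]]]] ?]]. Qed.

Lemma color_index_inj (c x y : 'I_4) : c != x -> c != y ->
  (3 %| (color_index c y)%:Z - (color_index c x)%:Z)%Z = (y == x).
Proof. by move: c x y; do 3![case=> [[|[|[|[|//]]]] ?]]. Qed.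

Lemma positive_colors_swap (c x y : 'I_4) : c != x -> c != y -> x != y ->
  positive_colors c x y = ~~ positive_colors c y x.
Proof. by move: c x y; do 3![case=> [[|[|[|[|//]]]] ?]]. Qed.

(** * Sums of signatures around a vertex *)

Section links.
Variables (R : realType) (V : finType) (K : simplicial_complex V) (o : orientation K).
Hypothesis hK : sphere_triangulation R K.
Variable a : V -> 'I_4.
Hypothesis aP : forall u v, skeleton K u v -> a u != a v.

Lemma next_color v u : skeleton K v u -> a u != a (link_next o v u).
Proof. by move/(pos_next o hK)/pos_nbr => [_ _]; exact: aP. Qed.

(** [h] is the partial sum of signatures along the link, started at the index of the first colour to
    be right modulo 3; the vanishing total closes it up at the step back to the start. *)
Lemma link_height v : link_sum o a v = 0 -> exists h : V -> int,
  forall u, skeleton K v u ->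
    h (link_next o v u) = h u + sgn o a v u /\
    (3 %| h u - (color_index (a v) (a u))%:Z)%Z.
Proof.
move=> sum0; have [[u0 vu0]|isol] := pselect (exists u, skeleton K v u); last first.
  by exists (fun=> 0) => u vu; case: isol; exists u.
pose nx := link_next o v; pose s := sgn o a v.
have nx_inj : injective nx := next_inj (o := o) hK (v := v).
pose it i := iter i nx u0.
pose m := order nx u0.
have vit i : skeleton K v (it i).
  by elim: i => [//|i IHi]; rewrite /it iterS (next_nbr _ hK).
have sum_it : \sum_(j < m) s (it j) = 0.
  rewrite -[RHS]sum0 /link_sum (eq_bigl (mem (orbit nx u0))); last first.
    move=> u; rewrite inE -fconnect_orbit.
    apply/idP/idP => [vu|]; first exact: (link_orbit o hK vu0 vu).
    by move/iter_findex => <-; exact: vit.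
  rewrite -big_uniq ?orbit_uniq //= (big_nth u0) size_orbit big_mkord.
  by apply: eq_bigr => j _; rewrite /orbit nth_traject.
pose t0 : int := (color_index (a v) (a u0))%:Z.
pose H i := t0 + \sum_(j < i) s (it j).
exists (fun u => H (findex nx u0 u)) => u vu.
have cu : fconnect nx u0 u by exact: (link_orbit o hK vu0 vu).
rewrite -(iter_findex cu); move: (findex nx u0 u) (findex_max cu) => i im.
rewrite -/(it i) -/nx -/(it i.+1) (_ : nx (it i) = it i.+1) //.
have HS k : H k.+1 = H k + s (it k) by rewrite /H big_ord_recr addrA.
rewrite (_ : findex nx u0 (it i) = i); last exact: findex_iter.
split.
  have [im'|im'] := ltnP i.+1 m.
    by rewrite (_ : findex nx u0 (it i.+1) = i.+1) ?HS //; exact: findex_iter.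
  have e : i.+1 = m by apply/eqP; rewrite eqn_leq im im'.
  rewrite -HS e (_ : it m = u0); last exact: iter_order.
  by rewrite findex0 /H big_ord0 sum_it.
elim: i {im} => [|i IHi]; first by rewrite /H big_ord0 addr0 subrr.
rewrite HS (_ : _ - _ = (H i - (color_index (a v) (a (it i)))%:Z) -
  ((color_index (a v) (a (it i.+1)))%:Z - (color_index (a v) (a (it i)))%:Z - s (it i)));
  last ring.
apply: rpredB => //; apply: color_index_step; try exact: aP.
exact: next_color.
Qed.

Lemma balanced_farey_lift : (forall v, link_sum o a v = 0) ->
  exists phi : V -> vec,
  (forall v, slope (phi v) = a v) /\ farey_map (skeleton K) phi.
Proof.
move=> bal; have [h hP] := choice (fun v => link_height (bal v)).
have s1 v u : sgn o a v u ^+ 2 = 1 by rewrite /sgn; case: ifP.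
have [||||phi [p1 p2 p3]] := @farey_lift R V K hK (fun v => a v) h.
- by move=> v; exact: ltn_ord.
- by move=> u v /aP.
- move=> v u w /and4P[vu vw uw Ks].
  case/orP: (pos_or o vu vw uw Ks) => p; have [n1 n2 _] := pos_nbr p.
    have := (hP v u n1).1; rewrite (link_nextE p) => ->.
    by rewrite (_ : _ - _ = - sgn o a v u) ?sqrrN //; ring.
  have := (hP v w n1).1; rewrite (link_nextE p) => ->.
  by rewrite (_ : _ - _ = sgn o a v w) //; ring.
- move=> v u w vu vw.
  rewrite /= (_ : (a u == a w :> nat) = (a u == a w)) // -(color_index_inj (aP vw) (aP vu)).
  have := (hP v u vu).2; have := (hP v w vw).2.
  move: (h v u) (h v w) (color_index _ _)%:Z (color_index _ _)%:Z => x y i j.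
  clear; lia.
exists phi; split=> //; split=> // u v /andP[uv Kuv]; exact: p3.
Qed.

(** Passing to the successor exchanges the two link colours of the face and so negates the
    signature; reindexing shows that the sum equals its opposite. *)
Lemma link_sum_alternating v :
  (forall u, skeleton K v u -> a (link_next o v (link_next o v u)) = a u) ->
  link_sum o a v = 0.
Proof.
move=> alt.
have E : link_sum o a v = - link_sum o a v.
  rewrite {1}/link_sum (reindex_inj (next_inj (o := o) hK (v := v))) /=.
  rewrite -sumrN; apply: eq_big => u; first by rewrite (next_nbr _ hK).
  rewrite (next_nbr _ hK) => vu; rewrite /sgn alt //.
  have vn : skeleton K v (link_next o v u) by rewrite (next_nbr _ hK).
  have ne : a (link_next o v u) != a u by rewrite eq_sym next_color.
  by rewrite (positive_colors_swap (aP vn) (aP vu) ne); case: (positive_colors _ _ _).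
by move: E; clear; lia.
Qed.

Lemma link_sum_two_colors v (d : 'I_4) : d != a v ->
  (forall u, skeleton K v u -> a u != d) -> link_sum o a v = 0.
Proof.
move=> dv nd; apply: link_sum_alternating => u vu.
have vn : skeleton K v (link_next o v u) by rewrite (next_nbr _ hK).
have vnn : skeleton K v (link_next o v (link_next o v u)) by rewrite (next_nbr _ hK).
move: dv (nd _ vu) (nd _ vn) (nd _ vnn) (next_color vu) (next_color vn)
  (aP vu) (aP vn) (aP vnn); clear nd.
move: (a v) (a u) (a (link_next o v (link_next o v u))) (a (link_next o v u)) d => c0 c1 c2 c3 c4.
move: (ltn_ord c0) (ltn_ord c1) (ltn_ord c2) (ltn_ord c3) (ltn_ord c4).
rewrite -!val_eqE /= => *; apply: val_inj => /=; lia.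
Qed.

End links.

(** * Invariance under single changes *)

Section single_changes.
Variables (R : realType) (V : finType) (K : simplicial_complex V) (o : orientation K).
Hypothesis hK : sphere_triangulation R K.

Lemma link_sum_change (a b : V -> 'I_4) (x : V) :
  (forall u v, skeleton K u v -> a u != a v) ->
  (forall u v, skeleton K u v -> b u != b v) ->
  a x != b x -> (forall u, u != x -> a u = b u) ->
  forall v, link_sum o a v = link_sum o b v.
Proof.
move=> aP bP abx ab v.
have nx u : skeleton K x u -> u != x by move=> /skeleton_irr; rewrite eq_sym.
have [->|vx] := eqVneq v x.
  (* At x itself the neighbours avoid both the old and the new colour, so both sums vanish. *)
  rewrite (link_sum_two_colors o hK aP (d := b x)) 1?eq_sym //; last first.
    by move=> u xu; rewrite ab ?nx // eq_sym bP.
  rewrite (link_sum_two_colors o hK bP (d := a x)) //.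
  by move=> u xu; rewrite -ab ?nx // eq_sym aP.
have vab : a v = b v by exact: ab.
have same u : u != x -> link_next o v u != x -> sgn o a v u = sgn o b v u.
  by move=> ux nux; rewrite /sgn vab !ab.
have [vsx|vsx] := boolP (skeleton K v x); last first.
  apply: eq_bigr => u vu; apply: same.
    by apply: contraNneq vsx => <-.
  by apply: contraNneq vsx => <-; rewrite (next_nbr _ hK).
have [y py] := prev_exists o hK vsx.
have [vy _ yx] := pos_nbr py.
have yx' : y != x := skeleton_irr yx.
have pn := pos_next o hK vsx; set z := link_next o v x in pn.
have [_ vz xz] := pos_nbr pn.
have zx : z != x := nx z xz.
(* The colour of v and the two colours of x are distinct and all excluded at y and z, which leaves
   one colour for both. *)
have ayz : a y = a z.
  move: (ab y yx') (ab z zx) vab abx (aP _ _ vsx) (bP _ _ vsx) (aP _ _ yx) (bP _ _ yx)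
    (aP _ _ xz) (bP _ _ xz) (aP _ _ vy) (aP _ _ vz).
  move=> <- <- <-.
  move: (a x) (b x) (a y) (a z) (a v) => c0 c1 c2 c3 c4.
  move: (ltn_ord c0) (ltn_ord c1) (ltn_ord c2) (ltn_ord c3) (ltn_ord c4).
  rewrite -!val_eqE /= => *; apply: val_inj => /=; lia.
have cancel (c : V -> 'I_4) : (forall u v, skeleton K u v -> c u != c v) -> c y = c z ->
    sgn o c v y = - sgn o c v x.
  move=> cP cyz; rewrite /sgn (link_nextE py) -/z -cyz.
  rewrite (positive_colors_swap (cP _ _ vy) (cP _ _ vsx) (cP _ _ yx)).
  by case: (positive_colors _ _ _).
(* Only the terms of x and of its predecessor y involve the colour of x, and they cancel in both
   sums. *)
rewrite /link_sum (bigD1 x vsx) (bigD1 y) ?vy //= [RHS](bigD1 x vsx) [in RHS](bigD1 y) ?vy //=.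
rewrite !addrA (cancel a aP ayz) (cancel b bP) -?ab //.
rewrite !subrr; congr (_ + _); apply: eq_bigr => u /andP[/andP[vu ux] uy].
apply: same => //; apply: contra uy => /eqP e; apply/eqP.
by apply: (next_inj (o := o) hK (v := v)); rewrite e (link_nextE py).
Qed.

Lemma component_link_sum (alpha : coloring (skeleton K) 4) :
  alpha \in three_coloring_component (skeleton K) ->
  forall v, link_sum o (val alpha) v = 0.
Proof.
have prop (c : coloring (skeleton K) 4) u v : skeleton K u v -> val c u != val c v.
  by move=> uv; have /forallP/(_ u)/forallP/(_ v)/implyP/(_ uv) := valP c.
rewrite inE => /existsP[b /andP[b3 /connectP[p]]].
have b0 v : link_sum o (val b) v = 0.
  have [d dP] : exists d : 'I_4, d \notin [set val b v | v : V]%SET.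
    apply/existsP; rewrite -negb_forall; apply/negP => /forallP all.
    move: b3; rewrite /three_coloring leqNgt => /negP; apply.
    apply: (@leq_trans #|[set: 'I_4]%SET|); first by rewrite cardsT card_ord.
    by apply/subset_leq_card/fintype.subsetP => c _; exact: all.
  have nd u : val b u != d.
    by apply: contraNneq dP => <-; exact: imset_f.
  by apply: (link_sum_two_colors o hK (prop b) (d := d)); rewrite 1?eq_sym.
elim: p b b0 {b3} => [|c p IHp] b b0 /=; first by move=> _ ->.
case/andP => bc pp la; apply: (IHp c) => // v; rewrite -(b0 v).
have /cards1P[x ex] := bc.
have dif u : (val b u != val c u) = (u == x).
  by have := congr1 (fun A : {set V} => u \in A) ex; rewrite !inE.
apply/esym/(link_sum_change (x := x)); [exact: prop|exact: prop| |].
  by rewrite dif.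
by move=> u ux; apply/eqP/negPn; rewrite dif.
Qed.

End single_changes.

Theorem mainTheorem1 (R : realType) (V : finType) (K : simplicial_complex V)
    (hK : sphere_triangulation R K) (o : orientation K)
    (h3 : colorable (skeleton K) 3) (alpha : coloring (skeleton K) 4) :
  alpha \in three_coloring_component (skeleton K) <->
  balanced o (val alpha).
Proof.
rewrite (balancedE o hK); split; first exact: (component_link_sum o hK).
move=> bal.
have prop u v : skeleton K u v -> val alpha u != val alpha v.
  by move=> uv; have /forallP/(_ u)/forallP/(_ v)/implyP/(_ uv) := valP alpha.
have [phi [sl fm]] := balanced_farey_lift hK prop bal.
suff -> : alpha = slope_coloring fm.
  by apply: farey_component; [exact: skeleton_irr|exact: skeleton_sym].
by apply/val_inj/ffunP => v; apply/val_inj; rewrite !ffunE /= sl.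
Qed.
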